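(* Let $\rho_1,\rho_2,d,k,b>0$ be real constants and let $\chi=\chi(\psi_x)$ be a smooth function of one real variable with $\chi'(0)=b$. Consider the system of PDEs for $\varphi(t,x),\psi(t,x)$ $$\rho_1\varphi_{tt}-k(\varphi_x+\psi)_x=0,\qquad \rho_2\psi_{tt}-(\chi(\psi_x))_x+k(\varphi_x+\psi)+d\,\psi_t=0. \quad ( * )$$ The Lie point symmetry generators $X=\xi^1\partial_t+\xi^2\partial_x+\eta^1\partial_\varphi+\eta^2\partial_\psi$ (with $\xi^i,\eta^i$ functions of $(t,x,\varphi,\psi)$) admitted by $( * )$ are exactly the following. (1) If $\chi(\psi_x)=b\psi_x+\gamma$ for a constant $\gamma$: $$\xi^1=c_1,\quad \xi^2=c_2,\quad \eta^1=c_3\varphi+f(t,x),\quad \eta^2=c_3\psi+g(t,x),$$ with $c_1,c_2,c_3$ arbitrary real constants and $f,g$ arbitrary solutions of $kf_x+kg+d g_t-b g_{xx}+\rho_2 g_{tt}=0$, $\rho_1 f_{tt}-k f_{xx}-k g_x=0$. (2) If $\chi''\not\equiv 0$: $$\xi^1=c_1,\quad \xi^2=c_2,\quad \eta^1=c_3+c_4t+c_5x+c_6tx,\quad \eta^2=F(t),$$ with $c_1,\dots,c_6$ arbitrary real constants and $F$ any solution of $\rho_2F''(t)+dF'(t)+kF(t)=-c_6kt-c_5k$. Equivalently, the symmetry generators form the $8$-dimensional real vector space spanned by $$X_1=\partial_t,\quad X_2=\partial_x,\quad X_3=\partial_\varphi,\quad X_4=t\,\partial_\varphi,\quad X_5=x\,\partial_\varphi-\partial_\psi,$$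 together with $X_6,X_7,X_8$ given as follows: (2a) if $d^2-4k\rho_2=0$: $X_6=tx\,\partial_\varphi+\big(2\sqrt{\rho_2/k}-t\big)\partial_\psi$, $X_7=e^{-\sqrt{k/\rho_2}\,t}\partial_\psi$, $X_8=t\,e^{-\sqrt{k/\rho_2}\,t}\partial_\psi$; (2b) if $d^2-4k\rho_2=\lambda^2$ with $\lambda>0$: $X_6=tx\,\partial_\varphi+\Big(\frac{\sqrt{\lambda^2+4k\rho_2}}{k}-t\Big)\partial_\psi$, $X_7=e^{-\frac{\sqrt{\lambda^2+4k\rho_2}}{2\rho_2}t}\cosh\!\big(\frac{\lambda t}{2\rho_2}\big)\partial_\psi$, $X_8=e^{-\frac{\sqrt{\lambda^2+4k\rho_2}}{2\rho_2}t}\sinh\!\big(\frac{\lambda t}{2\rho_2}\big)\partial_\psi$; (2c) if $d^2-4k\rho_2=-\mu^2$ with $\mu>0$: $X_6=tx\,\partial_\varphi+\Big(\frac{\sqrt{4k\rho_2-\mu^2}}{k}-t\Big)\partial_\psi$, $X_7=e^{-\frac{\sqrt{4k\rho_2-\mu^2}}{2\rho_2}t}\cos\!\big(\frac{\mu t}{2\rho_2}\big)\partial_\psi$, $X_8=e^{-\frac{\sqrt{4k\rho_2-\mu^2}}{2\rho_2}t}\sin\!\big(\frac{\mu t}{2\rho_2}\big)\partial_\psi$.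
   Context: The independent variables are $(t,x)\in(0,\infty)\times(0,L)$, the dependent variables are real valued $\varphi,\psi$, and $(\chi(\psi_x))_x$ denotes the total $x$-derivative, i.e. $\chi'(\psi_x)\psi_{xx}$. Write $(x^1,x^2)=(t,x)$, $(u^1,u^2)=(\varphi,\psi)$. For a smooth vector field $X=\xi^1\partial_t+\xi^2\partial_x+\eta^1\partial_\varphi+\eta^2\partial_\psi$ with coefficients depending on $(t,x,\varphi,\psi)$, its second prolongation is $$X^{[2]}=X+\eta^\mu_{i}\,\frac{\partial}{\partial u^\mu_i}+\eta^\mu_{i_1i_2}\frac{\partial}{\partial u^\mu_{i_1i_2}},\qquad \eta^\mu_{i}=D_i\eta^\mu-\sum_{j=1}^2(D_i\xi^j)u^\mu_j,\qquad \eta^\mu_{i_1i_2}=D_{i_2}\eta^\mu_{i_1}-\sum_{j=1}^2(D_{i_2}\xi^j)u^\mu_{i_1j},$$ where $D_i$ is the total derivative with respect to $x^i$ and the sum in $X^{[2]}$ is over $\mu$ and over the distinct first- and second-order derivative coordinates. $X$ is a Lie point symmetry generator admitted by the system if $X^{[2]}$ applied to the left-hand side of each of the two equations vanishes at all points of the second-order jet space at which both equations hold.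
   Formalization: In (1), that all generators have the stated form is claimed only when bρ₁ = kρ₂ and d² = 4kρ₂ do not both hold; when both hold the system admits a further generator with ξ¹ = x, so the printed claim fails there. *)

(* Defs.v *)
From Stdlib Require Export Reals List.
#[warnings="-ambiguous-paths"] From Coquelicot Require Export Coquelicot.
Export ListNotations.
#[global] Open Scope R_scope.

(* One index type for (x^1, x^2) = (t, x) and for (u^1, u^2) = (phi, psi). *)
Inductive idx := I1 | I2.

Definition sum2 (F : idx -> R) : R := F I1 + F I2.

(* Functions of (t, x, phi, psi). *)
Definition bfun := R -> R -> R -> R -> R.

Definition strip (L t x : R) : Prop := 0 < t /\ 0 < x < L.

Inductive bcoord := Bt | Bx | Bphi | Bpsi.

Definition bval (c : bcoord) (t x u v : R) : R :=
  match c with Bt => t | Bx => x | Bphi => u | Bpsi => v end.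

Definition bslice (c : bcoord) (f : bfun) (t x u v : R) : R -> R :=
  match c with
  | Bt => fun s => f s x u v
  | Bx => fun s => f t s u v
  | Bphi => fun s => f t x s v
  | Bpsi => fun s => f t x u s
  end.

Definition bpartial (c : bcoord) (f : bfun) : bfun :=
  fun t x u v => Derive (bslice c f t x u v) (bval c t x u v).

Definition continuous_on_strip (L : R) (f : bfun) : Prop :=
  forall t x u v, strip L t x ->
    continuous (fun q : R * R * R * R =>
                  f (fst (fst (fst q))) (snd (fst (fst q))) (snd (fst q)) (snd q))
               (t, x, u, v).

(* C^n on (0,oo) x (0,L) x R x R; values outside this set are irrelevant. *)
Fixpoint Ck (L : R) (n : nat) (f : bfun) : Prop :=
  match n with
  | O => continuous_on_strip L f
  | S m => continuous_on_strip L f /\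
           forall c : bcoord,
             (forall t x u v, strip L t x ->
                ex_derive (bslice c f t x u v) (bval c t x u v)) /\
             Ck L m (bpartial c f)
  end.

Definition smooth (L : R) (f : bfun) : Prop := forall n, Ck L n f.

Definition smooth_tx (L : R) (f : R -> R -> R) : Prop :=
  smooth L (fun t x _ _ => f t x).

Record vfield := VField { xi : idx -> bfun; eta : idx -> bfun }.

Definition mkvf (xi1 xi2 eta1 eta2 : bfun) : vfield :=
  VField (fun i => match i with I1 => xi1 | I2 => xi2 end)
         (fun m => match m with I1 => eta1 | I2 => eta2 end).

Definition smooth_vf (L : R) (X : vfield) : Prop :=
  (forall i, smooth L (xi X i)) /\ (forall m, smooth L (eta X m)).

(* Second-order derivative coordinates are indexed by unordered pairs, so that
   u^m_12 and u^m_21 are the same coordinate. *)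
Inductive idx2 := P11 | P12 | P22.

Definition pair2 (i j : idx) : idx2 :=
  match i, j with
  | I1, I1 => P11
  | I2, I2 => P22
  | _, _ => P12
  end.

Inductive jcoord :=
  | Jx (i : idx)
  | Ju (m : idx)
  | Jd (m i : idx)
  | Jdd (m : idx) (s : idx2).

Definition jcoord_eq_dec (c c' : jcoord) : {c = c'} + {c <> c'}.
Proof. repeat decide equality. Defined.

Definition jet := jcoord -> R.

Definition upd (p : jet) (c : jcoord) (s : R) : jet :=
  fun c' => if jcoord_eq_dec c' c then s else p c'.

Definition jpartial (c : jcoord) (G : jet -> R) : jet -> R :=
  fun p => Derive (fun s => G (upd p c s)) (p c).

Definition lift (f : bfun) : jet -> R :=
  fun p => f (p (Jx I1)) (p (Jx I2)) (p (Ju I1)) (p (Ju I2)).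

(* Total derivative of a function of the jet variables of order at most one. *)
Definition totalD (i : idx) (G : jet -> R) : jet -> R :=
  fun p =>
    jpartial (Jx i) G p
    + sum2 (fun m => p (Jd m i) * jpartial (Ju m) G p)
    + sum2 (fun m => sum2 (fun j => p (Jdd m (pair2 i j)) * jpartial (Jd m j) G p)).

Definition eta1 (X : vfield) (m i : idx) : jet -> R :=
  fun p => totalD i (lift (eta X m)) p
           - sum2 (fun j => totalD i (lift (xi X j)) p * p (Jd m j)).

Definition eta2 (X : vfield) (m i1 i2 : idx) : jet -> R :=
  fun p => totalD i2 (eta1 X m i1) p
           - sum2 (fun j => totalD i2 (lift (xi X j)) p * p (Jdd m (pair2 i1 j))).

Definition prolong2 (X : vfield) (G : jet -> R) : jet -> R :=
  fun p =>
    sum2 (fun i => lift (xi X i) p * jpartial (Jx i) G p)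
    + sum2 (fun m => lift (eta X m) p * jpartial (Ju m) G p)
    + sum2 (fun m => sum2 (fun i => eta1 X m i p * jpartial (Jd m i) G p))
    + sum2 (fun m => eta2 X m I1 I1 p * jpartial (Jdd m P11) G p
                     + eta2 X m I1 I2 p * jpartial (Jdd m P12) G p
                     + eta2 X m I2 I2 p * jpartial (Jdd m P22) G p).

Definition lhs1 (rho1 k : R) : jet -> R :=
  fun p => rho1 * p (Jdd I1 P11) - k * (p (Jdd I1 P22) + p (Jd I2 I2)).

Definition lhs2 (rho2 d k : R) (chi : R -> R) : jet -> R :=
  fun p => rho2 * p (Jdd I2 P11) - Derive chi (p (Jd I2 I2)) * p (Jdd I2 P22)
           + k * (p (Jd I1 I2) + p (Ju I2)) + d * p (Jd I2 I1).

Definition admitted_by (L rho1 rho2 d k : R) (chi : R -> R) (X : vfield) : Prop :=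
  forall p : jet,
    strip L (p (Jx I1)) (p (Jx I2)) ->
    lhs1 rho1 k p = 0 -> lhs2 rho2 d k chi p = 0 ->
    prolong2 X (lhs1 rho1 k) p = 0 /\ prolong2 X (lhs2 rho2 d k chi) p = 0.

Definition point_symmetry (L rho1 rho2 d k : R) (chi : R -> R) (X : vfield) : Prop :=
  smooth_vf L X /\ admitted_by L rho1 rho2 d k chi X.

(* Equality of vector fields on their domain (0,oo) x (0,L) x R x R. *)
Definition eq_vf (L : R) (X Y : vfield) : Prop :=
  forall t x u v, strip L t x ->
    (forall i, xi X i t x u v = xi Y i t x u v) /\
    (forall m, eta X m t x u v = eta Y m t x u v).

Definition zero_vf : vfield := VField (fun _ _ _ _ _ => 0) (fun _ _ _ _ _ => 0).

Definition axpy_vf (a : R) (X Y : vfield) : vfield :=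
  VField (fun i t x u v => a * xi X i t x u v + xi Y i t x u v)
         (fun m t x u v => a * eta X m t x u v + eta Y m t x u v).

Fixpoint lincomb (a : list R) (B : list vfield) : vfield :=
  match a, B with
  | c :: a', X :: B' => axpy_vf c X (lincomb a' B')
  | _, _ => zero_vf
  end.

Definition lin_indep (L : R) (B : list vfield) : Prop :=
  forall a, length a = length B -> eq_vf L (lincomb a B) zero_vf ->
    forall c, In c a -> c = 0.

(* The vector fields satisfying P are exactly the linear span of B, and B is
   linearly independent over R. *)
Definition is_basis (L : R) (P : vfield -> Prop) (B : list vfield) : Prop :=
  lin_indep L B /\
  forall X, P X <-> exists a, length a = length B /\ eq_vf L X (lincomb a B).

Definition solves_linear (L rho1 rho2 d k b : R) (f g : R -> R -> R) : Prop :=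
  forall t x, strip L t x ->
    k * Derive (fun y => f t y) x + k * g t x + d * Derive (fun s => g s x) t
      - b * Derive_n (fun y => g t y) 2 x + rho2 * Derive_n (fun s => g s x) 2 t = 0
    /\ rho1 * Derive_n (fun s => f s x) 2 t - k * Derive_n (fun y => f t y) 2 x
         - k * Derive (fun y => g t y) x = 0.

Definition linear_form (L rho1 rho2 d k b : R) (X : vfield) : Prop :=
  exists (c1 c2 c3 : R) (f g : R -> R -> R),
    smooth_tx L f /\ smooth_tx L g /\ solves_linear L rho1 rho2 d k b f g /\
    eq_vf L X (mkvf (fun _ _ _ _ => c1) (fun _ _ _ _ => c2)
                    (fun t x phi psi => c3 * phi + f t x)
                    (fun t x phi psi => c3 * psi + g t x)).

(* When b * rho1 = k * rho2 (equal wave speeds) and d^2 = 4 * k * rho2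
   simultaneously, the linear system also admits
     x d/dt + (k/rho1) t d/dx
       + ((b/d) psi - (d/(4 rho2)) x phi) d/dphi
       + ((k/d) phi - (d/(4 rho2)) x psi) d/dpsi,
   which is not of the form [linear_form]. *)
Definition exceptional (rho1 rho2 d k b : R) : Prop :=
  b * rho1 = k * rho2 /\ d ^ 2 - 4 * k * rho2 = 0.

(* F is only assumed twice differentiable; smoothness follows from the ODE. *)
Definition solves_ode (rho2 d k c5 c6 : R) (F : R -> R) : Prop :=
  forall t, 0 < t ->
    ex_derive F t /\ ex_derive (Derive F) t /\
    rho2 * Derive_n F 2 t + d * Derive F t + k * F t = - c6 * k * t - c5 * k.

Definition nonlinear_form (L rho2 d k : R) (X : vfield) : Prop :=
  exists (c1 c2 c3 c4 c5 c6 : R) (F : R -> R),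
    solves_ode rho2 d k c5 c6 F /\
    eq_vf L X (mkvf (fun _ _ _ _ => c1) (fun _ _ _ _ => c2)
                    (fun t x _ _ => c3 + c4 * t + c5 * x + c6 * t * x)
                    (fun t _ _ _ => F t)).

Definition cst (c : R) : bfun := fun _ _ _ _ => c.

Definition X1 : vfield := mkvf (cst 1) (cst 0) (cst 0) (cst 0).
Definition X2 : vfield := mkvf (cst 0) (cst 1) (cst 0) (cst 0).
Definition X3 : vfield := mkvf (cst 0) (cst 0) (cst 1) (cst 0).
Definition X4 : vfield := mkvf (cst 0) (cst 0) (fun t _ _ _ => t) (cst 0).
Definition X5 : vfield := mkvf (cst 0) (cst 0) (fun _ x _ _ => x) (cst (-1)).

(* t x d/dphi + (A - t) d/dpsi *)
Definition X6 (A : R) : vfield :=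
  mkvf (cst 0) (cst 0) (fun t x _ _ => t * x) (fun t _ _ _ => A - t).

(* h(t) d/dpsi *)
Definition dpsi (h : R -> R) : vfield :=
  mkvf (cst 0) (cst 0) (cst 0) (fun t _ _ _ => h t).

(* Main.v *)
Require Import Defs.
From Stdlib Require Import Lra FunctionalExtensionality Classical.

(** Both equations can be solved for phi_tt and psi_tt, so the remaining jet
    coordinates of order at most two are free on the solution manifold, and each
    symmetry condition is a polynomial identity in them, except that psi_x also
    enters through chi.  Its coefficients are the determining equations.

    The coefficient of phi_tx forces xi^1, xi^2 to depend on (t, x) only
    ([base_components]); the other coefficients are collected in
    [determining_equations].  Several of them carry the factor
    rho1 chi'(p) - k rho2, the difference of the two squared wave speeds at psi_x = p up
    to a positive factor.

    If that factor is nonzero for some p, which holds whenever chi is not affine,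
    the unknowns decouple: the cross terms eta^1_psi and eta^2_phi and the
    derivatives xi^1_x, xi^2_t vanish, and the damping term d psi_t rules out the
    scaling of (t, x) ([rigid_unequal_speeds]).  If chi' = b and the speeds agree,
    cross terms could survive; the damping then makes them all proportional to
    eta^2_phi, for which there remains (d^2 - 4 k rho2) eta^2_phi = 0
    ([rigid_equal_speeds]).  In both cases X has constant xi and
    eta = e (phi, psi) + (f, g)(t, x) ([rigid_affine]).

    For such X the prolongation sends each equation to e times itself plus a
    remainder that involves f, g, psi_x and psi_xx only ([affine_admitted]).  For
    affine chi the remainder is the linear system for (f, g).  When chi'' is nonzero
    somewhere, its psi_xx term chi''(q) (g_x + e q) forces e = 0 and g_x = 0, and what
    is left makes f bilinear in t and x and makes g = F(t) solve a forced damped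
    oscillator equation ([nonlinear_affine_form]).

    That equation has a particular solution affine in t, and the quotient of two
    Wronskians of homogeneous solutions is constant, so a pair with nonvanishing
    Wronskian spans ([fundamental_span]).  The three regimes of d^2 - 4 k rho2 are
    instances of one pair exp(- al t) C, exp(- al t) S with C' = q S, S' = r C
    ([damped_fundamental]). *)

(** * Smooth functions on the strip *)

(** Coefficients matter only on the strip, which is open: this relation is therefore
    preserved by partial derivatives. *)
Definition agree (L : R) (f g : bfun) : Prop :=
  forall t x u v, strip L t x -> f t x u v = g t x u v.

Lemma agree_sym L f g : agree L f g -> agree L g f.
Proof. intros H t x u v Hs; symmetry; apply H, Hs. Qed.

Lemma strip_open L t x : strip L t x ->
  exists delta : posreal, forall t' x',
    Rabs (t' - t) < delta -> Rabs (x' - x) < delta -> strip L t' x'.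
Proof.
intros [Ht [Hx0 HxL]].
assert (Hm : 0 < Rmin t (Rmin x (L - x))).
{ repeat apply Rmin_glb_lt; lra. }
exists (mkposreal _ Hm); simpl; intros t' x' H1 H2.
pose proof (Rmin_l t (Rmin x (L - x))); pose proof (Rmin_r t (Rmin x (L - x))).
pose proof (Rmin_l x (L - x)); pose proof (Rmin_r x (L - x)).
apply Rabs_def2 in H1; apply Rabs_def2 in H2.
unfold strip; lra.
Qed.

Lemma bslice_agree L f g c t x u v : agree L f g -> strip L t x ->
  locally (bval c t x u v) (fun s => bslice c f t x u v s = bslice c g t x u v s).
Proof.
intros Hfg Hs; destruct (strip_open L t x Hs) as [e He].
exists e; intros s Hb; assert (Hb' : Rabs (s - bval c t x u v) < e) by exact Hb.
assert (Hz : forall a, Rabs (a - a) < e).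
{ intros a; rewrite Rminus_diag, Rabs_R0; apply cond_pos. }
destruct c; simpl in *; apply Hfg; auto.
Qed.

Lemma bpartial_agree L c f g :
  agree L f g -> agree L (bpartial c f) (bpartial c g).
Proof.
intros H t x u v Hs; unfold bpartial; apply Derive_ext_loc.
exact (bslice_agree L f g c t x u v H Hs).
Qed.

Lemma bpartial_const c a t x u v : bpartial c (fun _ _ _ _ => a) t x u v = 0.
Proof. destruct c; exact (Derive_const _ _). Qed.

Lemma bpartial_zero L c a f :
  agree L f (fun _ _ _ _ => a) -> agree L (bpartial c f) (fun _ _ _ _ => 0).
Proof.
intros H t x u v Hs; rewrite (bpartial_agree L c _ _ H) by exact Hs.
apply bpartial_const.
Qed.

Definition bdiff (L : R) (f : bfun) : Prop := forall c t x u v, strip L t x ->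
  ex_derive (bslice c f t x u v) (bval c t x u v).

Lemma bdiff_agree L f g : bdiff L f -> agree L f g -> bdiff L g.
Proof.
intros Hf H c t x u v Hs; apply (ex_derive_ext_loc (bslice c f t x u v));
  [apply bslice_agree with L | apply Hf]; assumption.
Qed.

Lemma bpartial_plus L c f g t x u v : bdiff L f -> bdiff L g -> strip L t x ->
  bpartial c (fun t x u v => f t x u v + g t x u v) t x u v
  = bpartial c f t x u v + bpartial c g t x u v.
Proof.
intros Hf Hg Hs; specialize (Hf c t x u v Hs); specialize (Hg c t x u v Hs).
destruct c; simpl in *; apply Derive_plus; assumption.
Qed.

Lemma bpartial_mult L c f g t x u v : bdiff L f -> bdiff L g -> strip L t x ->
  bpartial c (fun t x u v => f t x u v * g t x u v) t x u v
  = bpartial c f t x u v * g t x u v + f t x u v * bpartial c g t x u v.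
Proof.
intros Hf Hg Hs; specialize (Hf c t x u v Hs); specialize (Hg c t x u v Hs).
destruct c; simpl in *; apply Derive_mult; assumption.
Qed.

Lemma bpartial_scal c a f t x u v :
  bpartial c (fun t x u v => a * f t x u v) t x u v = a * bpartial c f t x u v.
Proof. destruct c; exact (Derive_scal _ _ _). Qed.

Lemma Ck_bdiff L n f : Ck L (S n) f -> bdiff L f.
Proof. intros [_ H] c t x u v Hs; apply H, Hs. Qed.

Lemma Ck_bpartial L n f c : Ck L (S n) f -> Ck L n (bpartial c f).
Proof. intros [_ H]; apply H. Qed.

Lemma Ck_S_intro L n f : continuous_on_strip L f -> bdiff L f ->
  (forall c, Ck L n (bpartial c f)) -> Ck L (S n) f.
Proof. intros H1 H2 H3; split; [exact H1 | intros c; split; auto]. Qed.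

Lemma Ck_pred L n f : Ck L (S n) f -> Ck L n f.
Proof.
revert f; induction n as [|n IH]; intros f H; [exact (proj1 H)|].
apply Ck_S_intro; [exact (proj1 H) | exact (Ck_bdiff L _ f H) |].
intros c; apply IH, Ck_bpartial, H.
Qed.

Lemma continuous_agree L f g :
  continuous_on_strip L f -> agree L f g -> continuous_on_strip L g.
Proof.
intros Hf H t x u v Hs.
apply continuous_ext_loc with (fun q : R * R * R * R =>
  f (fst (fst (fst q))) (snd (fst (fst q))) (snd (fst q)) (snd q)); [|apply Hf, Hs].
destruct (strip_open L t x Hs) as [e He]; exists e; intros q Hq.
apply H, He; apply Hq.
Qed.

Lemma Ck_agree L n f g : Ck L n f -> agree L f g -> Ck L n g.
Proof.
revert f g; induction n as [|n IH]; intros f g Hf H.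
{ exact (continuous_agree L f g Hf H). }
apply Ck_S_intro.
- apply continuous_agree with f; [exact (proj1 Hf) | exact H].
- apply bdiff_agree with f; [exact (Ck_bdiff L _ _ Hf) | exact H].
- intros c; apply IH with (bpartial c f);
    [apply Ck_bpartial, Hf | apply bpartial_agree, H].
Qed.

Lemma Ck_const L n a : Ck L n (fun _ _ _ _ => a).
Proof.
revert a; induction n as [|n IH]; intros a.
{ intros t x u v _; apply continuous_const. }
apply Ck_S_intro.
- intros t x u v _; apply continuous_const.
- intros c t x u v _; destruct c; apply ex_derive_const.
- intros c; apply Ck_agree with (fun _ _ _ _ => 0); [apply IH|].
  intros t x u v _; symmetry; apply bpartial_const.
Qed.

Lemma Ck_coord L n c : Ck L n (bval c).
Proof.
assert (C0 : continuous_on_strip L (bval c)).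
{ intros t x u v _; apply filterlim_locally; intros e; exists e; intros q Hq.
  destruct c; apply Hq. }
destruct n as [|n]; [exact C0|].
apply Ck_S_intro; [exact C0 | |].
- intros c' t x u v _; destruct c, c'; simpl;
    (apply ex_derive_const || apply ex_derive_id).
- intros c'.
  apply Ck_agree with (fun _ _ _ _ => bpartial c' (bval c) 0 0 0 0);
    [apply Ck_const|].
  intros t x u v _; destruct c, c'; unfold bpartial; simpl;
    rewrite ?Derive_const, ?Derive_id; reflexivity.
Qed.

Lemma Ck_plus L n f g : Ck L n f -> Ck L n g ->
  Ck L n (fun t x u v => f t x u v + g t x u v).
Proof.
assert (C0 : forall f g, continuous_on_strip L f -> continuous_on_strip L g ->
  continuous_on_strip L (fun t x u v => f t x u v + g t x u v)).
{ intros f' g' Hf Hg t x u v Hs; specialize (Hf t x u v Hs);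
  specialize (Hg t x u v Hs); exact (continuous_plus _ _ _ Hf Hg). }
revert f g; induction n as [|n IH]; intros f g Hf Hg; [apply C0; assumption|].
apply Ck_S_intro; [apply C0; [apply Hf | apply Hg] | |].
- intros c t x u v Hs; pose proof (Ck_bdiff L _ _ Hf c t x u v Hs) as H1.
  pose proof (Ck_bdiff L _ _ Hg c t x u v Hs) as H2.
  destruct c; exact (ex_derive_plus _ _ _ H1 H2).
- intros c; apply Ck_agree with
    (fun t x u v => bpartial c f t x u v + bpartial c g t x u v).
  + apply IH; apply Ck_bpartial; assumption.
  + intros t x u v Hs; symmetry; apply bpartial_plus with L; trivial;
      eapply Ck_bdiff; eassumption.
Qed.

(** Leibniz' rule brings back f and g undifferentiated, hence the use of
    [Ck_pred] in the induction. *)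
Lemma Ck_mult L n f g : Ck L n f -> Ck L n g ->
  Ck L n (fun t x u v => f t x u v * g t x u v).
Proof.
assert (C0 : forall f g, continuous_on_strip L f -> continuous_on_strip L g ->
  continuous_on_strip L (fun t x u v => f t x u v * g t x u v)).
{ intros f' g' Hf Hg t x u v Hs; specialize (Hf t x u v Hs);
  specialize (Hg t x u v Hs); exact (continuous_mult _ _ _ Hf Hg). }
revert f g; induction n as [|n IH]; intros f g Hf Hg; [apply C0; assumption|].
apply Ck_S_intro; [apply C0; [apply Hf | apply Hg] | |].
- intros c t x u v Hs; pose proof (Ck_bdiff L _ _ Hf c t x u v Hs) as H1.
  pose proof (Ck_bdiff L _ _ Hg c t x u v Hs) as H2.
  destruct c; exact (ex_derive_mult _ _ _ H1 H2).
- intros c; apply Ck_agree with (fun t x u v =>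
    bpartial c f t x u v * g t x u v + f t x u v * bpartial c g t x u v).
  + apply Ck_plus; apply IH; try (apply Ck_bpartial; assumption);
      apply Ck_pred; assumption.
  + intros t x u v Hs; symmetry; apply bpartial_mult with L; trivial;
      eapply Ck_bdiff; eassumption.
Qed.

Lemma smooth_bdiff L f : smooth L f -> bdiff L f.
Proof. intros H; exact (Ck_bdiff L 0 f (H 1%nat)). Qed.

Lemma smooth_bpartial L c f : smooth L f -> smooth L (bpartial c f).
Proof. intros H n; apply Ck_bpartial, H. Qed.

Lemma smooth_agree L f g : smooth L f -> agree L f g -> smooth L g.
Proof. intros Hf H n; apply Ck_agree with f; auto. Qed.

Lemma smooth_const L a : smooth L (fun _ _ _ _ => a).
Proof. intros n; apply Ck_const. Qed.

Lemma smooth_coord L c : smooth L (bval c).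
Proof. intros n; apply Ck_coord. Qed.

Lemma smooth_plus L f g : smooth L f -> smooth L g ->
  smooth L (fun t x u v => f t x u v + g t x u v).
Proof. intros Hf Hg n; apply Ck_plus; auto. Qed.

Lemma smooth_mult L f g : smooth L f -> smooth L g ->
  smooth L (fun t x u v => f t x u v * g t x u v).
Proof. intros Hf Hg n; apply Ck_mult; auto. Qed.

(** Schwarz's theorem in the plane of the coordinates c and c'; smoothness on the
    strip provides the continuity of both mixed derivatives. *)
Lemma bpartial_comm L c c' f : smooth L f ->
  agree L (bpartial c (bpartial c' f)) (bpartial c' (bpartial c f)).
Proof.
intros Hf t x u v Hs.
assert (D1 := smooth_bdiff L f Hf).
assert (D2 : forall c, bdiff L (bpartial c f))
  by (intros e; apply smooth_bdiff, smooth_bpartial, Hf).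
assert (C2 : forall c c', continuous_on_strip L (bpartial c (bpartial c' f))).
{ intros e e'; apply (smooth_bpartial L e _ (smooth_bpartial L e' _ Hf) 0%nat). }
destruct (strip_open L t x Hs) as [e0 He0].
assert (Hz : forall (e : posreal) a, Rabs (a - a) < e).
{ intros e a; rewrite Rminus_diag, Rabs_R0; apply cond_pos. }
assert (HC : forall c c' (eps : posreal), exists delta : posreal,
  forall t' x' u' v', Rabs (t' - t) < delta -> Rabs (x' - x) < delta ->
    Rabs (u' - u) < delta -> Rabs (v' - v) < delta ->
    Rabs (bpartial c (bpartial c' f) t' x' u' v'
          - bpartial c (bpartial c' f) t x u v) < eps).
{ intros e e' eps.
  destruct (proj1 (filterlim_locally _ _) (C2 e e' t x u v Hs) eps) as [del Hd].
  exists del; intros t' x' u' v' H1 H2 H3 H4.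
  apply (Hd (t', x', u', v')); repeat split; assumption. }
destruct c, c'; try reflexivity;
match goal with
|- bpartial ?c (bpartial ?c' _) _ _ _ _ = _ =>
  refine (Schwarz _ _ _ _ _ _);
  [ exists e0; intros a b' Ha Hb; repeat split;
    [ refine (D1 c _ _ _ _ _) | refine (D1 c' _ _ _ _ _)
    | refine (D2 c' c _ _ _ _ _) | refine (D2 c c' _ _ _ _ _) ];
    apply He0; auto
  | intros eps; destruct (HC c c' eps) as [del Hd];
    exists del; intros a b' Ha Hb; apply Hd; auto
  | intros eps; destruct (HC c' c eps) as [del Hd];
    exists del; intros a b' Ha Hb; apply Hd; auto ]
end.
Qed.

(** * Total derivatives and the prolongation *)

(** The base coordinate named by an index of x^i, and by an index of u^m. *)
Definition bx (i : idx) : bcoord := match i with I1 => Bt | I2 => Bx end.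
Definition bu (m : idx) : bcoord := match m with I1 => Bphi | I2 => Bpsi end.

(** Differentiability along every jet coordinate: what makes the total derivative a
    derivation at p. *)
Definition jdiff (G : jet -> R) (p : jet) : Prop :=
  forall c, ex_derive (fun s => G (upd p c s)) (p c).

Lemma upd_same p c : upd p c (p c) = p.
Proof.
apply functional_extensionality; intros c'; unfold upd.
destruct (jcoord_eq_dec c' c); congruence.
Qed.

Lemma jdiff_plus G H p : jdiff G p -> jdiff H p -> jdiff (fun q => G q + H q) p.
Proof. intros HG HH c; exact (ex_derive_plus _ _ _ (HG c) (HH c)). Qed.

Lemma jdiff_minus G H p : jdiff G p -> jdiff H p -> jdiff (fun q => G q - H q) p.
Proof. intros HG HH c; exact (ex_derive_minus _ _ _ (HG c) (HH c)). Qed.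

Lemma jdiff_mult G H p : jdiff G p -> jdiff H p -> jdiff (fun q => G q * H q) p.
Proof. intros HG HH c; exact (ex_derive_mult _ _ _ (HG c) (HH c)). Qed.

Lemma jdiff_coord c p : jdiff (fun q => q c) p.
Proof.
intros c'; unfold upd; destruct (jcoord_eq_dec c c').
- apply ex_derive_id.
- apply ex_derive_const.
Qed.

Lemma jdiff_lift L f p : bdiff L f -> strip L (p (Jx I1)) (p (Jx I2)) ->
  jdiff (lift f) p.
Proof.
intros Hf Hs c.
destruct c as [[|]|[|]|? ?|? ?];
  [ exact (Hf Bt _ _ _ _ Hs) | exact (Hf Bx _ _ _ _ Hs)
  | exact (Hf Bphi _ _ _ _ Hs) | exact (Hf Bpsi _ _ _ _ Hs)
  | exact (ex_derive_const (lift f p) _) | exact (ex_derive_const (lift f p) _) ].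
Qed.

Lemma totalD_plus i G H p : jdiff G p -> jdiff H p ->
  totalD i (fun q => G q + H q) p = totalD i G p + totalD i H p.
Proof.
intros HG HH.
assert (E : forall c, jpartial c (fun q => G q + H q) p
                      = jpartial c G p + jpartial c H p)
  by (intros c; exact (Derive_plus _ _ _ (HG c) (HH c))).
unfold totalD, sum2; rewrite !E; ring.
Qed.

Lemma totalD_minus i G H p : jdiff G p -> jdiff H p ->
  totalD i (fun q => G q - H q) p = totalD i G p - totalD i H p.
Proof.
intros HG HH.
assert (E : forall c, jpartial c (fun q => G q - H q) p
                      = jpartial c G p - jpartial c H p)
  by (intros c; exact (Derive_minus _ _ _ (HG c) (HH c))).
unfold totalD, sum2; rewrite !E; ring.
Qed.

Lemma totalD_mult i G H p : jdiff G p -> jdiff H p ->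
  totalD i (fun q => G q * H q) p = totalD i G p * H p + G p * totalD i H p.
Proof.
intros HG HH.
assert (E : forall c, jpartial c (fun q => G q * H q) p
                      = jpartial c G p * H p + G p * jpartial c H p).
{ intros c; unfold jpartial.
  rewrite (Derive_mult (fun s => G (upd p c s)) (fun s => H (upd p c s)))
    by (apply HG || apply HH).
  rewrite upd_same; reflexivity. }
unfold totalD, sum2; rewrite !E; ring.
Qed.

Lemma totalD_Jd i m j p : totalD i (fun q => q (Jd m j)) p = p (Jdd m (pair2 i j)).
Proof.
assert (E : forall c, jpartial c (fun q => q (Jd m j)) p
                      = if jcoord_eq_dec (Jd m j) c then 1 else 0).
{ intros c; unfold jpartial, upd; destruct (jcoord_eq_dec (Jd m j) c).
  - apply Derive_id.
  - apply Derive_const. }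
unfold totalD, sum2; rewrite !E; destruct m, j; simpl; ring.
Qed.

(** The total derivative D_i f of a coefficient, written with its partial
    derivatives. *)
Definition D1 (i : idx) (f : bfun) : jet -> R :=
  fun p => lift (bpartial (bx i) f) p
           + sum2 (fun m => p (Jd m i) * lift (bpartial (bu m) f) p).

Lemma totalD_lift i f p : totalD i (lift f) p = D1 i f p.
Proof.
assert (E : forall m j, jpartial (Jd m j) (lift f) p = 0)
  by (intros m j; exact (Derive_const (lift f p) _)).
unfold totalD, D1, sum2; rewrite !E; destruct i.
- change (jpartial (Jx I1) (lift f) p) with (lift (bpartial Bt f) p).
  change (jpartial (Ju I1) (lift f) p) with (lift (bpartial Bphi f) p).
  change (jpartial (Ju I2) (lift f) p) with (lift (bpartial Bpsi f) p).
  simpl; ring.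
- change (jpartial (Jx I2) (lift f) p) with (lift (bpartial Bx f) p).
  change (jpartial (Ju I1) (lift f) p) with (lift (bpartial Bphi f) p).
  change (jpartial (Ju I2) (lift f) p) with (lift (bpartial Bpsi f) p).
  simpl; ring.
Qed.

Lemma eta1_D1 X m i :
  eta1 X m i = fun p => D1 i (eta X m) p - sum2 (fun j => D1 i (xi X j) p * p (Jd m j)).
Proof.
apply functional_extensionality; intros p; unfold eta1, sum2.
rewrite !totalD_lift; reflexivity.
Qed.

Definition pure (i : idx) : idx2 := pair2 i i.

(** The second total derivative D_i D_i f of a coefficient.  Mixed partial
    derivatives occur in one fixed order each: a base variable outermost, and psi
    outside phi. *)
Definition D2 (i : idx) (f : bfun) : jet -> R :=
  fun p =>
    lift (bpartial (bx i) (bpartial (bx i) f)) p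
    + 2 * sum2 (fun m => p (Jd m i) * lift (bpartial (bx i) (bpartial (bu m) f)) p)
    + p (Jd I1 i) ^ 2 * lift (bpartial Bphi (bpartial Bphi f)) p
    + 2 * p (Jd I1 i) * p (Jd I2 i) * lift (bpartial Bpsi (bpartial Bphi f)) p
    + p (Jd I2 i) ^ 2 * lift (bpartial Bpsi (bpartial Bpsi f)) p
    + sum2 (fun m => p (Jdd m (pure i)) * lift (bpartial (bu m) f) p).

(** The summands are matched syntactically: unification up to conversion would unfold
    the derivatives hidden in the coefficients. *)
Ltac jdiff_tac H :=
  lazymatch goal with
  | |- jdiff (fun q => @?G q + @?K q) ?p =>
      refine (jdiff_plus G K p _ _); cbv beta; jdiff_tac H
  | |- jdiff (fun q => @?G q - @?K q) ?p =>
      refine (jdiff_minus G K p _ _); cbv beta; jdiff_tac H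
  | |- jdiff (fun q => @?G q * @?K q) ?p =>
      refine (jdiff_mult G K p _ _); cbv beta; jdiff_tac H
  | |- jdiff (fun q => q ?c) ?p => exact (jdiff_coord c p)
  | |- _ => H
  end.

Ltac totalD_step H :=
  match goal with
  | |- context [totalD ?i (fun q => @?G q + @?K q) ?p] =>
      rewrite (totalD_plus i G K p) by (cbv beta; jdiff_tac H)
  | |- context [totalD ?i (fun q => @?G q - @?K q) ?p] =>
      rewrite (totalD_minus i G K p) by (cbv beta; jdiff_tac H)
  | |- context [totalD ?i (fun q => @?G q * @?K q) ?p] =>
      rewrite (totalD_mult i G K p) by (cbv beta; jdiff_tac H)
  | |- context [totalD ?i (fun q => q (Jd ?m ?j)) ?p] =>
      rewrite (totalD_Jd i m j p)
  end; cbv beta.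

Lemma jdiff_D1 L i f p : smooth L f -> strip L (p (Jx I1)) (p (Jx I2)) ->
  jdiff (D1 i f) p.
Proof.
intros Hf Hs.
assert (H : forall c, jdiff (lift (bpartial c f)) p)
  by (intros c; apply jdiff_lift with L;
      [apply smooth_bdiff, smooth_bpartial, Hf | exact Hs]).
unfold D1, sum2; jdiff_tac ltac:(apply H).
Qed.

Lemma totalD_D1 L i f p : smooth L f -> strip L (p (Jx I1)) (p (Jx I2)) ->
  totalD i (D1 i f) p = D2 i f p.
Proof.
intros Hf Hs.
assert (H : forall c, jdiff (lift (bpartial c f)) p)
  by (intros c; apply jdiff_lift with L;
      [apply smooth_bdiff, smooth_bpartial, Hf | exact Hs]).
assert (C : forall c c', lift (bpartial c (bpartial c' f)) p
                         = lift (bpartial c' (bpartial c f)) p)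
  by (intros c c'; exact (bpartial_comm L c c' f Hf _ _ _ _ Hs)).
unfold D1 at 1, sum2.
repeat totalD_step ltac:(apply H).
change (fun q => lift ?g q) with (lift g).
rewrite !totalD_lift.
unfold D1, D2, sum2, pure; simpl.
rewrite (C Bphi (bx i)), (C Bpsi (bx i)), (C Bphi Bpsi).
ring.
Qed.

(** Leibniz' rule for D_i (D_i eta - sum_j (D_i xi^j) u_j), where D_i u_j = u_ij.
    Only repeated indices are needed, since neither equation involves a tx
    derivative. *)
Lemma eta2_D2 L X m i p : smooth_vf L X -> strip L (p (Jx I1)) (p (Jx I2)) ->
  eta2 X m i i p
  = D2 i (eta X m) p
    - sum2 (fun j => D2 i (xi X j) p * p (Jd m j)
                     + 2 * D1 i (xi X j) p * p (Jdd m (pair2 i j))).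
Proof.
intros [Hxi Heta] Hs.
assert (He := jdiff_D1 L i _ p (Heta m) Hs).
assert (Hx : forall j, jdiff (D1 i (xi X j)) p)
  by (intros j; exact (jdiff_D1 L i _ p (Hxi j) Hs)).
unfold eta2; rewrite eta1_D1; unfold sum2; rewrite !totalD_lift.
repeat totalD_step ltac:(first [apply He | apply Hx]).
rewrite !(totalD_D1 L) by auto; ring.
Qed.

Ltac jpartial_lhs := unfold jpartial, upd, lhs1, lhs2; simpl;
  apply is_derive_unique; auto_derive; auto; ring.

Lemma prolong2_lhs1 rho1 k X p :
  prolong2 X (lhs1 rho1 k) p
  = rho1 * eta2 X I1 I1 I1 p - k * (eta2 X I1 I2 I2 p + eta1 X I2 I2 p).
Proof.
unfold prolong2, sum2.
assert (E : forall c, jpartial c (lhs1 rho1 k) p =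
  match c with Jdd I1 P11 => rho1 | Jdd I1 P22 => - k | Jd I2 I2 => - k | _ => 0 end).
{ intros c; destruct c as [[|]|[|]|[|] [|]|[|] [| |]]; jpartial_lhs. }
rewrite !E; ring.
Qed.

Lemma prolong2_lhs2 rho2 d k chi X p : ex_derive (Derive chi) (p (Jd I2 I2)) ->
  prolong2 X (lhs2 rho2 d k chi) p
  = rho2 * eta2 X I2 I1 I1 p - Derive chi (p (Jd I2 I2)) * eta2 X I2 I2 I2 p
    - Derive_n chi 2 (p (Jd I2 I2)) * p (Jdd I2 P22) * eta1 X I2 I2 p
    + k * (eta1 X I1 I2 p + lift (eta X I2) p) + d * eta1 X I2 I1 p.
Proof.
intros Hc; unfold prolong2, sum2.
assert (E : forall c, jpartial c (lhs2 rho2 d k chi) p =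
  match c with
  | Jdd I2 P11 => rho2
  | Jdd I2 P22 => - Derive chi (p (Jd I2 I2))
  | Jd I2 I2 => - Derive_n chi 2 (p (Jd I2 I2)) * p (Jdd I2 P22)
  | Jd I1 I2 => k | Ju I2 => k | Jd I2 I1 => d | _ => 0 end).
{ intros c; destruct c as [[|]|[|]|[|] [|]|[|] [| |]]; try jpartial_lhs.
  unfold jpartial, upd, lhs2; simpl; apply is_derive_unique.
  set (g := Derive chi) in *; change (Derive (fun x => Derive (fun x0 => chi x0) x))
    with (Derive g).
  auto_derive; [exact Hc|].
  change (Derive (fun x => g x)) with (Derive g); ring. }
rewrite !E; ring.
Qed.

(** * Determining equations *)

(** The arguments are grouped by unknown: u stands for phi and v for psi. *)
Definition mkjet (t x u v ut ux vt vx utt utx uxx vtt vtx vxx : R) : jet :=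
  fun c => match c with
  | Jx I1 => t | Jx I2 => x | Ju I1 => u | Ju I2 => v
  | Jd I1 I1 => ut | Jd I1 I2 => ux | Jd I2 I1 => vt | Jd I2 I2 => vx
  | Jdd I1 P11 => utt | Jdd I1 P12 => utx | Jdd I1 P22 => uxx
  | Jdd I2 P11 => vtt | Jdd I2 P12 => vtx | Jdd I2 P22 => vxx
  end.

Lemma D1_base L i f p : (forall m, agree L (bpartial (bu m) f) (fun _ _ _ _ => 0)) ->
  strip L (p (Jx I1)) (p (Jx I2)) -> D1 i f p = lift (bpartial (bx i) f) p.
Proof.
intros H Hs.
assert (E : forall m, lift (bpartial (bu m) f) p = 0)
  by (intros m; exact (H m _ _ _ _ Hs)).
unfold D1, sum2; rewrite !E; ring.
Qed.

Lemma D2_base L i f p : (forall m, agree L (bpartial (bu m) f) (fun _ _ _ _ => 0)) ->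
  strip L (p (Jx I1)) (p (Jx I2)) ->
  D2 i f p = lift (bpartial (bx i) (bpartial (bx i) f)) p.
Proof.
intros H Hs.
assert (E : forall m, lift (bpartial (bu m) f) p = 0)
  by (intros m; exact (H m _ _ _ _ Hs)).
assert (E2 : forall c m, lift (bpartial c (bpartial (bu m) f)) p = 0)
  by (intros c m; exact (bpartial_zero L c 0 _ (H m) _ _ _ _ Hs)).
unfold D2, sum2.
pose proof (E2 Bphi I1) as E3; pose proof (E2 Bpsi I1) as E4;
  pose proof (E2 Bpsi I2) as E5; simpl in E3, E4, E5.
rewrite !E, !E2, E3, E4, E5; ring.
Qed.

Lemma scaled_zero a z : a <> 0 -> a * z = 0 -> z = 0.
Proof. intros Ha H; destruct (Rmult_integral _ _ H); [contradiction | assumption]. Qed.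

(** The symmetry conditions at jets with prescribed coordinates, the two equations
    being solved for phi_tt and psi_tt. *)
Definition admitted_raw (L rho1 rho2 d k : R) (chi : R -> R) (X : vfield) : Prop :=
  forall t x u v ut ux vt vx utt utx uxx vtt vtx vxx, strip L t x ->
  let p := mkjet t x u v ut ux vt vx utt utx uxx vtt vtx vxx in
  rho1 * utt = k * (uxx + vx) ->
  rho2 * vtt = Derive chi vx * vxx - k * (ux + v) - d * vt ->
  rho1 * eta2 X I1 I1 I1 p - k * (eta2 X I1 I2 I2 p + eta1 X I2 I2 p) = 0 /\
  rho2 * eta2 X I2 I1 I1 p - Derive chi vx * eta2 X I2 I2 I2 p
    - Derive_n chi 2 vx * vxx * eta1 X I2 I2 p
    + k * (eta1 X I1 I2 p + eta X I2 t x u v) + d * eta1 X I2 I1 p = 0.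

Lemma admitted_by_raw L rho1 rho2 d k chi X :
  (forall s, ex_derive (Derive chi) s) ->
  admitted_by L rho1 rho2 d k chi X -> admitted_raw L rho1 rho2 d k chi X.
Proof.
intros Hc HX t x u v ut ux vt vx utt utx uxx vtt vtx vxx Hs p E1 E2.
destruct (HX p) as [H1 H2]; [exact Hs | | |].
- unfold lhs1, p; simpl; lra.
- unfold lhs2, p; simpl; lra.
- rewrite prolong2_lhs1 in H1; rewrite prolong2_lhs2 in H2 by apply Hc.
  split; [exact H1 | exact H2].
Qed.

(** The coordinate phi_tx occurs only in the first condition, through
    - 2 rho1 (D_t xi^2) phi_tx + 2 k (D_x xi^1) phi_tx.  Its coefficient is affine in
    the first derivatives, and D_t xi^2 involves phi_t, psi_t where D_x xi^1 involves
    phi_x, psi_x, so they balance only if no derivative along the fibre survives. *)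
Lemma base_components L rho1 rho2 d k chi X :
  0 < rho1 -> 0 < rho2 -> 0 < k -> smooth_vf L X ->
  admitted_raw L rho1 rho2 d k chi X ->
  forall t x u v, strip L t x ->
  (forall i m, bpartial (bu m) (xi X i) t x u v = 0) /\
  rho1 * bpartial Bt (xi X I2) t x u v = k * bpartial Bx (xi X I1) t x u v.
Proof.
intros Hr1 Hr2 Hk Hsm HX t x u v Hs.
assert (H : forall ut ux vt vx,
  rho1 * (bpartial Bt (xi X I2) t x u v + ut * bpartial Bphi (xi X I2) t x u v
          + vt * bpartial Bpsi (xi X I2) t x u v)
  = k * (bpartial Bx (xi X I1) t x u v + ux * bpartial Bphi (xi X I1) t x u v
          + vx * bpartial Bpsi (xi X I1) t x u v)).
{ intros ut ux vt vx.
  (* u_xx = - v_x makes u_tt vanish, and u_tx is then a free coordinate. *)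
  assert (G := fun utx => proj1 (HX t x u v ut ux vt vx 0 utx (- vx)
    ((- k * (ux + v) - d * vt) / rho2) 0 0 Hs ltac:(ring) ltac:(field; lra))).
  pose proof (G 0) as G0; pose proof (G 1) as G1; clear G.
  rewrite !(eta2_D2 L) in G0, G1 by (exact Hsm || exact Hs).
  rewrite !eta1_D1 in G0, G1.
  unfold D1, D2, sum2, lift in G0, G1; simpl in G0, G1; lra. }
assert (Z := H 0 0 0 0).
assert (Zu := H 1 0 0 0); assert (Zv := H 0 0 1 0).
assert (Yu := H 0 1 0 0); assert (Yv := H 0 0 0 1).
split; [intros [|] [|]; simpl | lra];
  match goal with |- ?z = 0 =>
    first [ apply (scaled_zero rho1 z); lra | apply (scaled_zero k z); lra ] end.
Qed.

Set Implicit Arguments.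

(** The coefficients of the two symmetry conditions at one point of the base, for
    xi^1, xi^2 depending on (t, x) only.  [D] and [DD] are first and second partial
    derivatives at that point, v the value of psi and z that of eta^2.  From
    [det_eta_ut] on, eta and zeta name the first and the second condition, and the
    suffix is the first derivative (u for phi, v for psi) whose coefficient is taken.
    The argument psi_x = p of chi' stays free; the last field is the second condition
    with all other free derivatives zero, the term in zeta_vv = 0 left out. *)
Record determining (rho1 rho2 d k : R) (chi : R -> R) (tau xi eta zeta : bfun)
    (v z : R) (D : bcoord -> bfun -> R) (DD : bcoord -> bcoord -> bfun -> R) : Prop := {
  det_wave : rho1 * D Bt xi = k * D Bx tau;
  det_stretch : D Bt tau = D Bx xi;
  det_eta_v : forall p, D Bpsi eta * (rho1 * Derive chi p - k * rho2) = 0;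
  det_zeta_u : forall p, D Bphi zeta * (rho1 * Derive chi p - k * rho2) = 0;
  det_tau_x : forall p, rho2 * D Bt xi = Derive chi p * D Bx tau;
  det_eta_uu : DD Bphi Bphi eta = 0;
  det_eta_uv : DD Bpsi Bphi eta = 0;
  det_eta_vv : DD Bpsi Bpsi eta = 0;
  det_zeta_uu : DD Bphi Bphi zeta = 0;
  det_zeta_uv : DD Bpsi Bphi zeta = 0;
  det_zeta_vv : DD Bpsi Bpsi zeta = 0;
  det_eta_ut : 2 * rho1 * DD Bt Bphi eta = rho1 * DD Bt Bt tau - k * DD Bx Bx tau;
  det_eta_vt : 2 * rho1 * rho2 * DD Bt Bpsi eta - rho1 * d * D Bpsi eta
               + k * rho2 * D Bx tau = 0;
  det_eta_ux : rho1 * k * D Bpsi eta + 2 * k * rho2 * DD Bx Bphi eta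
               + k * rho2 * D Bphi zeta
               + rho2 * (rho1 * DD Bt Bt xi - k * DD Bx Bx xi) = 0;
  det_eta_vx : D Bphi eta - 2 * D Bt tau - 2 * DD Bx Bpsi eta - D Bpsi zeta
               + D Bx xi = 0;
  det_zeta_ut : 2 * rho2 * DD Bt Bphi zeta - k * D Bx tau + d * D Bphi zeta = 0;
  det_zeta_vt : forall p, 2 * rho2 * DD Bt Bpsi zeta + d * D Bt tau
               - (rho2 * DD Bt Bt tau - Derive chi p * DD Bx Bx tau) = 0;
  det_zeta_ux : forall p, - k * (D Bpsi zeta - 2 * D Bt tau)
               - 2 * Derive chi p * DD Bx Bphi zeta + k * (D Bphi eta - D Bx xi) = 0;
  det_zeta_vx : forall p,
    rho1 * (rho2 * DD Bt Bt zeta - (D Bpsi zeta - 2 * D Bt tau) * k * v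
            - rho2 * DD Bt Bt xi * p
            - Derive chi p * (DD Bx Bx zeta + 2 * DD Bx Bpsi zeta * p - DD Bx Bx xi * p)
            + k * (D Bx eta + D Bpsi eta * p + z) + d * (D Bt zeta - D Bt xi * p))
    + rho2 * D Bphi zeta * k * p = 0
}.
Unset Implicit Arguments.

Lemma determining_equations L rho1 rho2 d k chi X :
  0 < rho1 -> 0 < rho2 -> 0 < k -> smooth_vf L X ->
  admitted_raw L rho1 rho2 d k chi X ->
  forall t x u v, strip L t x ->
  determining rho1 rho2 d k chi (xi X I1) (xi X I2) (eta X I1) (eta X I2)
    v (eta X I2 t x u v)
    (fun c f => bpartial c f t x u v)
    (fun c c' f => bpartial c (bpartial c' f) t x u v).
Proof.
intros Hr1 Hr2 Hk Hsm HX t x u v Hs.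
assert (HB : forall i m, agree L (bpartial (bu m) (xi X i)) (fun _ _ _ _ => 0)).
{ intros i m t' x' u' v' Hs'.
  apply (base_components L rho1 rho2 d k chi X Hr1 Hr2 Hk Hsm HX t' x' u' v' Hs'). }
assert (HW := proj2 (base_components L rho1 rho2 d k chi X Hr1 Hr2 Hk Hsm HX t x u v Hs)).
set (D := fun c f => bpartial c f t x u v).
set (DD := fun c c' f => bpartial c (bpartial c' f) t x u v).
set (tau := xi X I1) in *; set (xx := xi X I2) in *.
set (et := eta X I1) in *; set (ze := eta X I2) in *.
(* The conditions, multiplied by rho2 and by rho1, after elimination of phi_tt
   and psi_tt. *)
assert (H : forall ut ux vt vx utx uxx vtx vxx,
  rho2 * (rho1 * (DD Bt Bt et + 2 * (ut * DD Bt Bphi et + vt * DD Bt Bpsi et)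
                  + ut ^ 2 * DD Bphi Bphi et + 2 * ut * vt * DD Bpsi Bphi et
                  + vt ^ 2 * DD Bpsi Bpsi et)
          + (D Bphi et - 2 * D Bt tau) * (k * (uxx + vx))
          - rho1 * (DD Bt Bt tau * ut + DD Bt Bt xx * ux) - 2 * rho1 * D Bt xx * utx)
  + rho1 * D Bpsi et * (Derive chi vx * vxx - k * (ux + v) - d * vt)
  - rho2 * k * (DD Bx Bx et + 2 * (ux * DD Bx Bphi et + vx * DD Bx Bpsi et)
                + ux ^ 2 * DD Bphi Bphi et + 2 * ux * vx * DD Bpsi Bphi et
                + vx ^ 2 * DD Bpsi Bpsi et + uxx * D Bphi et + vxx * D Bpsi et
                - DD Bx Bx tau * ut - DD Bx Bx xx * ux - 2 * D Bx tau * utx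
                - 2 * D Bx xx * uxx
                + D Bx ze + ux * D Bphi ze + vx * D Bpsi ze
                - D Bx tau * vt - D Bx xx * vx) = 0
  /\
  rho1 * (rho2 * (DD Bt Bt ze + 2 * (ut * DD Bt Bphi ze + vt * DD Bt Bpsi ze)
                  + ut ^ 2 * DD Bphi Bphi ze + 2 * ut * vt * DD Bpsi Bphi ze
                  + vt ^ 2 * DD Bpsi Bpsi ze)
          + (D Bpsi ze - 2 * D Bt tau) * (Derive chi vx * vxx - k * (ux + v) - d * vt)
          - rho2 * (DD Bt Bt tau * vt + DD Bt Bt xx * vx) - 2 * rho2 * D Bt xx * vtx)
  + rho2 * D Bphi ze * (k * (uxx + vx))
  - rho1 * Derive chi vx *
      (DD Bx Bx ze + 2 * (ux * DD Bx Bphi ze + vx * DD Bx Bpsi ze)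
       + ux ^ 2 * DD Bphi Bphi ze + 2 * ux * vx * DD Bpsi Bphi ze
       + vx ^ 2 * DD Bpsi Bpsi ze + uxx * D Bphi ze + vxx * D Bpsi ze
       - DD Bx Bx tau * vt - DD Bx Bx xx * vx - 2 * D Bx tau * vtx
       - 2 * D Bx xx * vxx)
  - rho1 * Derive_n chi 2 vx * vxx *
      (D Bx ze + ux * D Bphi ze + vx * D Bpsi ze - D Bx tau * vt - D Bx xx * vx)
  + rho1 * k * (D Bx et + ux * D Bphi et + vx * D Bpsi et
                - D Bx tau * ut - D Bx xx * ux + ze t x u v)
  + rho1 * d * (D Bt ze + ut * D Bphi ze + vt * D Bpsi ze
                - D Bt tau * vt - D Bt xx * vx) = 0).
{ intros ut ux vt vx utx uxx vtx vxx.
  set (utt := k * (uxx + vx) / rho1).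
  set (vtt := (Derive chi vx * vxx - k * (ux + v) - d * vt) / rho2).
  assert (Ku : rho1 * utt = k * (uxx + vx)) by (unfold utt; field; lra).
  assert (Kv : rho2 * vtt = Derive chi vx * vxx - k * (ux + v) - d * vt)
    by (unfold vtt; field; lra).
  destruct (HX t x u v ut ux vt vx utt utx uxx vtt vtx vxx Hs Ku Kv) as [G1 G2].
  rewrite !(eta2_D2 L) in G1, G2 by (exact Hsm || exact Hs).
  rewrite (eta1_D1 X I2 I2) in G1, G2;
  rewrite (eta1_D1 X I1 I2), (eta1_D1 X I2 I1) in G2; unfold sum2 in G1, G2.
  rewrite !(D2_base L _ (xi X _)), !(D1_base L _ (xi X _)) in G1, G2
    by (exact Hs || apply HB).
  unfold D1, D2, sum2, lift in G1, G2; simpl in G1, G2.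
  rewrite <- Ku, <- Kv.
  clearbody utt vtt; clear Ku Kv.
  unfold D, DD; fold tau xx et ze in G1, G2.
  apply (Rmult_eq_compat_l rho2) in G1; apply (Rmult_eq_compat_l rho1) in G2.
  split; [rewrite Rmult_0_r in G1; rewrite <- G1
         | rewrite Rmult_0_r in G2; rewrite <- G2]; simpl; ring. }
assert (Q := fun ut ux vt vx utx uxx vtx vxx => proj1 (H ut ux vt vx utx uxx vtx vxx)).
assert (P := fun ut ux vt vx utx uxx vtx vxx => proj2 (H ut ux vt vx utx uxx vtx vxx)).
clear H; clearbody tau xx et ze; cbv beta in Q, P.
change (rho1 * D Bt xx = k * D Bx tau) in HW; clearbody D DD.
assert (Hkr : k * rho2 <> 0) by nra; assert (Hrr : rho1 * rho2 <> 0) by nra.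
(* Each coefficient is a finite difference of the conditions: increments 0, 1, -1 in
   the relevant derivatives separate the even and odd parts, and psi_xx = 0 removes
   chi''. *)
pose proof (Q 0 0 0 0 0 0 0 0) as Q0.
assert (P0 := fun p => P 0 0 0 p 0 0 0 0).
assert (HS : D Bt tau = D Bx xx).
{ pose proof (Q 0 0 0 0 0 1 0 0); apply Rminus_diag_uniq.
  apply (scaled_zero (k * rho2)); lra. }
split.
- exact HW.
- exact HS.
- intros p; pose proof (Q 0 0 0 p 0 0 0 1); pose proof (Q 0 0 0 p 0 0 0 0); lra.
- intros p; pose proof (P 0 0 0 p 0 1 0 0); pose proof (P0 p); lra.
- intros p; pose proof (P 0 0 0 p 0 0 1 0); pose proof (P0 p).
  apply Rminus_diag_uniq, (scaled_zero rho1); lra.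
- pose proof (Q 1 0 0 0 0 0 0 0); pose proof (Q (-1) 0 0 0 0 0 0 0).
  apply (scaled_zero (rho1 * rho2)); lra.
- pose proof (Q 1 0 0 0 0 0 0 0); pose proof (Q 0 0 1 0 0 0 0 0);
  pose proof (Q 1 0 1 0 0 0 0 0).
  apply (scaled_zero (rho1 * rho2)); lra.
- pose proof (Q 0 0 1 0 0 0 0 0); pose proof (Q 0 0 (-1) 0 0 0 0 0).
  apply (scaled_zero (rho1 * rho2)); lra.
- pose proof (P 1 0 0 0 0 0 0 0); pose proof (P (-1) 0 0 0 0 0 0 0); pose proof (P0 0).
  apply (scaled_zero (rho1 * rho2)); lra.
- pose proof (P 1 0 0 0 0 0 0 0); pose proof (P 0 0 1 0 0 0 0 0);
  pose proof (P 1 0 1 0 0 0 0 0); pose proof (P0 0).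
  apply (scaled_zero (rho1 * rho2)); lra.
- pose proof (P 0 0 1 0 0 0 0 0); pose proof (P 0 0 (-1) 0 0 0 0 0); pose proof (P0 0).
  apply (scaled_zero (rho1 * rho2)); lra.
- pose proof (Q 1 0 0 0 0 0 0 0); pose proof (Q (-1) 0 0 0 0 0 0 0).
  apply Rminus_diag_uniq, (scaled_zero rho2); lra.
- pose proof (Q 0 0 1 0 0 0 0 0); pose proof (Q 0 0 (-1) 0 0 0 0 0). lra.
- pose proof (Q 0 1 0 0 0 0 0 0); pose proof (Q 0 (-1) 0 0 0 0 0 0). lra.
- pose proof (Q 0 0 0 1 0 0 0 0); pose proof (Q 0 0 0 (-1) 0 0 0 0).
  apply (scaled_zero (k * rho2)); lra.
- pose proof (P 1 0 0 0 0 0 0 0); pose proof (P (-1) 0 0 0 0 0 0 0).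
  apply (scaled_zero rho1); lra.
- intros p; pose proof (P 0 0 1 p 0 0 0 0); pose proof (P 0 0 (-1) p 0 0 0 0).
  apply (scaled_zero rho1); lra.
- intros p.
  assert (Hm : DD Bpsi Bphi ze = 0).
  { pose proof (P 1 0 0 0 0 0 0 0); pose proof (P 0 0 1 0 0 0 0 0);
    pose proof (P 1 0 1 0 0 0 0 0); pose proof (P0 0).
    apply (scaled_zero (rho1 * rho2)); lra. }
  pose proof (P 0 1 0 p 0 0 0 0) as A; pose proof (P 0 (-1) 0 p 0 0 0 0) as B.
  rewrite Hm in A, B; apply (scaled_zero rho1); lra.
- intros p.
  assert (Hm : DD Bpsi Bpsi ze = 0).
  { pose proof (P 0 0 1 0 0 0 0 0); pose proof (P 0 0 (-1) 0 0 0 0 0);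
    pose proof (P0 0); apply (scaled_zero (rho1 * rho2)); lra. }
  pose proof (P0 p) as A; rewrite Hm in A; lra.
Qed.

(** * Rigidity of the coefficients *)

Lemma null_derive_const (f : R -> R) a b :
  (forall s, Rmin a b <= s <= Rmax a b -> ex_derive f s /\ Derive f s = 0) ->
  f a = f b.
Proof.
intros H.
assert (HD : forall s, Rmin a b <= s <= Rmax a b -> is_derive f s 0).
{ intros s Hs; destruct (H s Hs) as [He H0]; rewrite <- H0.
  apply Derive_correct, He. }
unfold Rmin, Rmax in HD; destruct (Rle_dec a b) as [Hab|Hab].
- destruct (Req_dec a b) as [->|Hne]; [reflexivity|].
  apply (eq_is_derive f a b HD); lra.
- symmetry; apply (eq_is_derive f b a HD); lra.
Qed.

(** The strip is a product of intervals, so the segment between two of its points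
    along one coordinate stays inside. *)
Lemma bslice_const L f c : bdiff L f -> agree L (bpartial c f) (fun _ _ _ _ => 0) ->
  forall t x u v t' x' u' v', strip L t x -> strip L t' x' ->
  bslice c f t x u v (bval c t x u v) = bslice c f t x u v (bval c t' x' u' v').
Proof.
intros Hf H t x u v t' x' u' v' [Ht Hx] [Ht' Hx']; apply null_derive_const.
intros s Hs.
assert (Hm : forall a b, Rmin a b <= s <= Rmax a b -> (a <= s <= b \/ b <= s <= a)).
{ intros a b; unfold Rmin, Rmax; destruct (Rle_dec a b); lra. }
apply Hm in Hs; clear Hm.
destruct c; simpl in Hs |- *;
  [ assert (Hst : strip L s x) by (unfold strip; lra);
    exact (conj (Hf Bt s x u v Hst) (H s x u v Hst))
  | assert (Hst : strip L t s) by (unfold strip; lra);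
    exact (conj (Hf Bx t s u v Hst) (H t s u v Hst))
  | assert (Hst : strip L t x) by (unfold strip; lra);
    exact (conj (Hf Bphi t x s v Hst) (H t x s v Hst))
  | assert (Hst : strip L t x) by (unfold strip; lra);
    exact (conj (Hf Bpsi t x u s Hst) (H t x u s Hst)) ].
Qed.

Lemma fibre_const L f : bdiff L f ->
  (forall m, agree L (bpartial (bu m) f) (fun _ _ _ _ => 0)) ->
  forall t x u v, strip L t x -> f t x u v = f t x 0 0.
Proof.
intros Hf H t x u v Hs.
transitivity (f t x 0 v).
- exact (bslice_const L f Bphi Hf (H I1) t x u v t x 0 v Hs Hs).
- exact (bslice_const L f Bpsi Hf (H I2) t x 0 v t x 0 0 Hs Hs).
Qed.

Lemma gradient_zero_const L f : 0 < L -> bdiff L f ->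
  (forall c, agree L (bpartial c f) (fun _ _ _ _ => 0)) ->
  agree L f (fun _ _ _ _ => f 1 (L / 2) 0 0).
Proof.
intros HL Hf H t x u v Hs.
assert (Hs0 : strip L 1 (L / 2)) by (unfold strip; lra).
assert (Hs1 : strip L 1 x) by (unfold strip in *; lra).
rewrite (fibre_const L f Hf (fun m => H (bu m)) t x u v Hs).
transitivity (f 1 x 0 0).
- exact (bslice_const L f Bt Hf (H Bt) t x 0 0 1 x 0 0 Hs Hs1).
- exact (bslice_const L f Bx Hf (H Bx) 1 x 0 0 1 (L / 2) 0 0 Hs1 Hs0).
Qed.

Definition zero_bfun : bfun := fun _ _ _ _ => 0.

Lemma bpartial_prop L c a b f g :
  agree L (fun t x u v => a * f t x u v) (fun t x u v => b * g t x u v) ->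
  agree L (fun t x u v => a * bpartial c f t x u v)
          (fun t x u v => b * bpartial c g t x u v).
Proof.
intros H t x u v Hs; rewrite <- !bpartial_scal.
exact (bpartial_agree L c _ _ H t x u v Hs).
Qed.

(** The first-order data of a field with constant xi and
    eta = e (phi, psi) + (f, g)(t, x). *)
Record rigid (L : R) (X : vfield) : Prop := {
  rigid_xi : forall i c, agree L (bpartial c (xi X i)) zero_bfun;
  rigid_eta_v : agree L (bpartial Bpsi (eta X I1)) zero_bfun;
  rigid_zeta_u : agree L (bpartial Bphi (eta X I2)) zero_bfun;
  rigid_slope : agree L (bpartial Bpsi (eta X I2)) (bpartial Bphi (eta X I1));
  rigid_const : forall c, agree L (bpartial c (bpartial Bphi (eta X I1))) zero_bfun
}.

(** Cross-differentiation: rho1 xi_t = k tau_x and tau_t = xi_x are a first-order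
    form of the wave equation, as are the Cauchy-Riemann equations of the Laplace
    equation. *)
Lemma wave_components L rho1 k tau xx : smooth L tau -> smooth L xx ->
  (forall t x u v, strip L t x ->
     rho1 * bpartial Bt xx t x u v = k * bpartial Bx tau t x u v
     /\ bpartial Bt tau t x u v = bpartial Bx xx t x u v) ->
  forall t x u v, strip L t x ->
  rho1 * bpartial Bt (bpartial Bt tau) t x u v
    = k * bpartial Bx (bpartial Bx tau) t x u v /\
  rho1 * bpartial Bt (bpartial Bt xx) t x u v
    = k * bpartial Bx (bpartial Bx xx) t x u v.
Proof.
intros Ht Hx H t x u v Hs.
assert (HW : agree L (fun t x u v => rho1 * bpartial Bt xx t x u v)
                     (fun t x u v => k * bpartial Bx tau t x u v))
  by (intros t' x' u' v' Hs'; apply H, Hs').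
assert (HS : agree L (bpartial Bt tau) (bpartial Bx xx))
  by (intros t' x' u' v' Hs'; apply H, Hs').
split.
- rewrite (bpartial_agree L Bt _ _ HS) by exact Hs.
  rewrite (bpartial_comm L Bt Bx xx Hx) by exact Hs.
  exact (bpartial_prop L Bx _ _ _ _ HW t x u v Hs).
- rewrite (bpartial_prop L Bt _ _ _ _ HW) by exact Hs; cbv beta.
  rewrite (bpartial_comm L Bt Bx tau Ht) by exact Hs.
  rewrite (bpartial_agree L Bx _ _ HS) by exact Hs; reflexivity.
Qed.

(** One value p0 where the speeds differ kills eta_v, zeta_u, tau_x and xi_t.  The
    surviving relation eta_u = tau_t + zeta_v then has vanishing t-derivative, which
    turns the psi_t coefficient into d tau_t = 0. *)
Lemma rigid_unequal_speeds L rho1 rho2 d k chi X p0 :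
  0 < rho1 -> 0 < rho2 -> 0 < k -> 0 < d -> smooth_vf L X ->
  admitted_raw L rho1 rho2 d k chi X ->
  rho1 * Derive chi p0 <> k * rho2 -> rigid L X.
Proof.
intros Hr1 Hr2 Hk Hd Hsm HX Hp.
assert (Hp' : rho1 * Derive chi p0 - k * rho2 <> 0) by lra.
assert (HD := determining_equations L rho1 rho2 d k chi X Hr1 Hr2 Hk Hsm HX).
assert (HB := base_components L rho1 rho2 d k chi X Hr1 Hr2 Hk Hsm HX).
destruct Hsm as [Hxi Heta].
assert (Wv := wave_components L rho1 k _ _ (Hxi I1) (Hxi I2)
  (fun t x u v Hs => conj (det_wave (HD t x u v Hs))
                          (det_stretch (HD t x u v Hs)))).
set (tau := xi X I1) in *; set (xx := xi X I2) in *.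
set (et := eta X I1) in *; set (ze := eta X I2) in *.
assert (Ev : agree L (bpartial Bpsi et) zero_bfun).
{ intros t x u v Hs; apply (scaled_zero _ _ Hp'); rewrite Rmult_comm.
  exact (det_eta_v (HD t x u v Hs) p0). }
assert (Zu : agree L (bpartial Bphi ze) zero_bfun).
{ intros t x u v Hs; apply (scaled_zero _ _ Hp'); rewrite Rmult_comm.
  exact (det_zeta_u (HD t x u v Hs) p0). }
assert (Tx : agree L (bpartial Bx tau) zero_bfun).
{ intros t x u v Hs; apply (scaled_zero _ _ Hp').
  pose proof (det_wave (HD t x u v Hs)) as H1.
  pose proof (det_tau_x (HD t x u v Hs) p0) as H2.
  cbv beta in H1, H2.
  apply (Rmult_eq_compat_l rho2) in H1; apply (Rmult_eq_compat_l rho1) in H2; lra. }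
assert (Xt : agree L (bpartial Bt xx) zero_bfun).
{ intros t x u v Hs; apply (scaled_zero rho1); [lra|].
  pose proof (det_wave (HD t x u v Hs)) as H1; cbv beta in H1.
  rewrite H1, Tx by exact Hs; unfold zero_bfun; ring. }
assert (Txx := bpartial_zero L Bx 0 _ Tx); assert (Xtt := bpartial_zero L Bt 0 _ Xt).
assert (Ttt : agree L (bpartial Bt (bpartial Bt tau)) zero_bfun).
{ intros t x u v Hs; apply (scaled_zero rho1); [lra|].
  rewrite (proj1 (Wv t x u v Hs)), Txx by exact Hs; ring. }
assert (Slope : agree L (bpartial Bphi et)
                  (fun t x u v => bpartial Bt tau t x u v + bpartial Bpsi ze t x u v)).
{ intros t x u v Hs.
  pose proof (det_eta_vx (HD t x u v Hs)) as H1.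
  pose proof (det_stretch (HD t x u v Hs)) as H2.
  cbv beta in H1, H2.
  rewrite (bpartial_zero L Bx 0 _ Ev) in H1 by exact Hs; lra. }
assert (Eut : agree L (bpartial Bt (bpartial Bphi et)) zero_bfun).
{ intros t x u v Hs.
  pose proof (det_eta_ut (HD t x u v Hs)) as H1; cbv beta in H1.
  rewrite (proj1 (Wv t x u v Hs)) in H1.
  apply (scaled_zero (2 * rho1)); lra. }
assert (Tt : agree L (bpartial Bt tau) zero_bfun).
{ intros t x u v Hs; apply (scaled_zero d); [lra|].
  pose proof (det_zeta_vt (HD t x u v Hs) p0) as H1.
  cbv beta in H1; rewrite Txx, Ttt in H1 by exact Hs; unfold zero_bfun in H1.
  pose proof (bpartial_agree L Bt _ _ Slope t x u v Hs) as H2.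
  rewrite (bpartial_plus L) in H2
    by (exact Hs || (apply smooth_bdiff, smooth_bpartial; apply Hxi || apply Heta)).
  rewrite Eut, Ttt in H2 by exact Hs; unfold zero_bfun in H2.
  replace (bpartial Bt (bpartial Bpsi ze) t x u v) with 0 in H1 by lra; lra. }
split; fold et ze.
- intros i c t x u v Hs; destruct (HB t x u v Hs) as [H0 _].
  destruct i, c; try exact (H0 _ I1); try exact (H0 _ I2);
    [ exact (Tt t x u v Hs) | exact (Tx t x u v Hs) | exact (Xt t x u v Hs) |].
  refine (eq_trans (eq_sym (det_stretch (HD t x u v Hs))) _).
  exact (Tt t x u v Hs).
- exact Ev.
- exact Zu.
- intros t x u v Hs; rewrite Slope, Tt by exact Hs.
  unfold zero_bfun; ring.
- intros c t x u v Hs; destruct c.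
  + exact (Eut t x u v Hs).
  + pose proof (det_eta_ux (HD t x u v Hs)) as H1.
    cbv beta in H1; rewrite (proj2 (Wv t x u v Hs)), Ev, Zu in H1 by exact Hs.
    unfold zero_bfun in *; apply (scaled_zero (2 * k * rho2)); [nra | lra].
  + exact (det_eta_uu (HD t x u v Hs)).
  + exact (det_eta_uv (HD t x u v Hs)).
Qed.

(** Write A, B, C, D for eta_u, eta_v, zeta_u, zeta_v, which depend on (t, x) only.
    Then A_t = 0 and rho1 B + rho2 C = - 2 rho2 A_x has vanishing t-derivative; since
    the transport equations of B and C carry damping of opposite signs, this gives
    rho2 C = rho1 B, hence C = - A_x and d C = k tau_x.  The relations between A and D
    give tau_t = 0, so tau_xx = 0, C_x = B_x = 0 and A = D.  The psi_x coefficient of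
    the second condition is then a multiple of (d^2 - 4 k rho2) C. *)
Lemma rigid_equal_speeds L rho1 rho2 d k b chi X :
  0 < rho1 -> 0 < rho2 -> 0 < k -> 0 < d -> 0 < b -> smooth_vf L X ->
  admitted_raw L rho1 rho2 d k chi X ->
  (forall p, Derive chi p = b) -> b * rho1 = k * rho2 -> d ^ 2 - 4 * k * rho2 <> 0 ->
  rigid L X.
Proof.
intros Hr1 Hr2 Hk Hd Hb Hsm HX Hchi Hspeed Hdisc.
assert (HD := determining_equations L rho1 rho2 d k chi X Hr1 Hr2 Hk Hsm HX).
assert (HB := base_components L rho1 rho2 d k chi X Hr1 Hr2 Hk Hsm HX).
destruct Hsm as [Hxi Heta].
assert (Wv := wave_components L rho1 k _ _ (Hxi I1) (Hxi I2)
  (fun t x u v Hs => conj (det_wave (HD t x u v Hs))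
                          (det_stretch (HD t x u v Hs)))).
set (tau := xi X I1) in *; set (xx := xi X I2) in *.
set (et := eta X I1) in *; set (ze := eta X I2) in *.
assert (B1 : forall c m, bdiff L (bpartial c (eta X m)))
  by (intros c m; apply smooth_bdiff, smooth_bpartial, Heta).
assert (Eut : agree L (bpartial Bt (bpartial Bphi et)) zero_bfun).
{ intros t x u v Hs.
  pose proof (det_eta_ut (HD t x u v Hs)) as H1; cbv beta in H1.
  rewrite (proj1 (Wv t x u v Hs)) in H1.
  apply (scaled_zero (2 * rho1)); lra. }
(* 2 rho2 A_x = - rho1 B - rho2 C, from the phi_x coefficient of the first
   condition. *)
assert (ABC : agree L (fun t x u v => 2 * rho2 * bpartial Bx (bpartial Bphi et) t x u v)
  (fun t x u v => - rho1 * bpartial Bpsi et t x u v + - rho2 * bpartial Bphi ze t x u v)).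
{ intros t x u v Hs.
  pose proof (det_eta_ux (HD t x u v Hs)) as H1.
  cbv beta in H1; rewrite (proj2 (Wv t x u v Hs)) in H1.
  apply Rminus_diag_uniq, (scaled_zero k); lra. }
assert (Auxt : agree L (bpartial Bt (bpartial Bx (bpartial Bphi et))) zero_bfun).
{ intros t x u v Hs.
  rewrite (bpartial_comm L Bt Bx) by (exact Hs || apply smooth_bpartial, Heta).
  exact (bpartial_zero L Bx 0 _ Eut t x u v Hs). }
(* The t-derivative of the previous relation, compared with the two transport
   equations; d > 0 enters here. *)
assert (CB : agree L (fun t x u v => rho2 * bpartial Bphi ze t x u v)
                     (fun t x u v => rho1 * bpartial Bpsi et t x u v)).
{ intros t x u v Hs.
  pose proof (bpartial_agree L Bt _ _ ABC t x u v Hs) as H1.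
  rewrite bpartial_scal, Auxt in H1 by exact Hs; unfold zero_bfun in H1.
  rewrite (bpartial_plus L) in H1; [ | | | exact Hs].
  2,3: apply smooth_bdiff, smooth_mult; [apply smooth_const | apply smooth_bpartial, Heta].
  rewrite !bpartial_scal in H1.
  pose proof (det_eta_vt (HD t x u v Hs)) as H2.
  pose proof (det_zeta_ut (HD t x u v Hs)) as H3.
  cbv beta in H2, H3; apply (Rmult_eq_compat_l rho2) in H3.
  apply (Rmult_eq_compat_l rho2) in H1.
  apply Rminus_diag_uniq, (scaled_zero d); lra. }
assert (CA : agree L (fun t x u v => 1 * bpartial Bphi ze t x u v)
                     (fun t x u v => -1 * bpartial Bx (bpartial Bphi et) t x u v)).
{ intros t x u v Hs; pose proof (CB t x u v Hs); pose proof (ABC t x u v Hs).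
  cbv beta in *; apply Rminus_diag_uniq, (scaled_zero (2 * rho2)); lra. }
assert (Ct : agree L (bpartial Bt (bpartial Bphi ze)) zero_bfun).
{ intros t x u v Hs; pose proof (bpartial_prop L Bt _ _ _ _ CA t x u v Hs) as H1.
  cbv beta in H1; rewrite Auxt in H1 by exact Hs; unfold zero_bfun in *; lra. }
assert (CT : agree L (fun t x u v => d * bpartial Bphi ze t x u v)
                     (fun t x u v => k * bpartial Bx tau t x u v)).
{ intros t x u v Hs.
  pose proof (det_zeta_ut (HD t x u v Hs)) as H3.
  cbv beta in H3; rewrite Ct in H3 by exact Hs; unfold zero_bfun in *; lra. }
assert (Tt : agree L (bpartial Bt tau) zero_bfun /\
  agree L (bpartial Bpsi ze) (fun t x u v => bpartial Bphi et t x u v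
                             + - 2 * bpartial Bx (bpartial Bpsi et) t x u v)).
{ assert (G : forall t x u v, strip L t x -> bpartial Bt tau t x u v = 0 /\
    bpartial Bpsi ze t x u v = bpartial Bphi et t x u v
                             + - 2 * bpartial Bx (bpartial Bpsi et) t x u v).
  { intros t x u v Hs.
    pose proof (det_stretch (HD t x u v Hs)) as H1.
    pose proof (det_eta_vx (HD t x u v Hs)) as H2.
    pose proof (det_zeta_ux (HD t x u v Hs) 0) as H3.
    cbv beta in H1, H2, H3; rewrite Hchi, <- H1 in H3.
    pose proof (bpartial_prop L Bx _ _ _ _ CB t x u v Hs) as H4; cbv beta in H4.
    assert (H5 : b * bpartial Bx (bpartial Bphi ze) t x u v
                 = k * bpartial Bx (bpartial Bpsi et) t x u v).
    { apply Rminus_diag_uniq, (scaled_zero rho2); [lra|].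
      apply (Rmult_eq_compat_l b) in H4.
      replace (b * (rho1 * bpartial Bx (bpartial Bpsi et) t x u v))
        with (k * rho2 * bpartial Bx (bpartial Bpsi et) t x u v) in H4
        by (rewrite <- Hspeed; ring).
      lra. }
    assert (H6 : bpartial Bphi et t x u v - bpartial Bpsi ze t x u v
                 + bpartial Bt tau t x u v
                 - 2 * bpartial Bx (bpartial Bpsi et) t x u v = 0)
      by (apply (scaled_zero k); lra).
    split; lra. }
  split; intros t x u v Hs; apply (G t x u v Hs). }
destruct Tt as [Tt Slope].
assert (Txx : agree L (bpartial Bx (bpartial Bx tau)) zero_bfun).
{ intros t x u v Hs; apply (scaled_zero k); [lra|].
  rewrite <- (proj1 (Wv t x u v Hs)), (bpartial_zero L Bt 0 _ Tt) by exact Hs; ring. }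
assert (Cx : agree L (bpartial Bx (bpartial Bphi ze)) zero_bfun).
{ intros t x u v Hs; apply (scaled_zero d); [lra|].
  pose proof (bpartial_prop L Bx _ _ _ _ CT t x u v Hs) as H1; cbv beta in H1.
  rewrite H1, Txx by exact Hs; unfold zero_bfun; ring. }
assert (Bx0 : agree L (bpartial Bx (bpartial Bpsi et)) zero_bfun).
{ intros t x u v Hs; apply (scaled_zero rho1); [lra|].
  pose proof (bpartial_prop L Bx _ _ _ _ CB t x u v Hs) as H1; cbv beta in H1.
  rewrite <- H1, Cx by exact Hs; unfold zero_bfun; ring. }
assert (AD : agree L (bpartial Bpsi ze) (bpartial Bphi et)).
{ intros t x u v Hs; rewrite Slope, Bx0 by exact Hs; unfold zero_bfun; ring. }
assert (Xx : agree L (bpartial Bx xx) zero_bfun).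
{ intros t x u v Hs.
  pose proof (det_stretch (HD t x u v Hs)) as H1.
  cbv beta in H1; rewrite <- H1; apply Tt, Hs. }
assert (C0 : agree L (bpartial Bphi ze) zero_bfun).
{ intros t x u v Hs.
  assert (Xtt : bpartial Bt (bpartial Bt xx) t x u v = 0).
  { apply (scaled_zero rho1); [lra|].
    rewrite (proj2 (Wv t x u v Hs)), (bpartial_zero L Bx 0 _ Xx) by exact Hs; ring. }
  pose proof (det_zeta_vx (HD t x u v Hs)) as R.
  (* The term linear in p is half the difference of the values at 1 and -1. *)
  pose proof (R 0) as R0; pose proof (R 1) as R1; pose proof (R (-1)) as R2; clear R.
  cbv beta in R0, R1, R2; rewrite !Hchi, Xtt in R0, R1, R2.
  rewrite (bpartial_zero L Bx 0 _ Xx), (bpartial_agree L Bx _ _ AD) in R0, R1, R2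
    by exact Hs.
  pose proof (CA t x u v Hs) as Q1; pose proof (CB t x u v Hs) as Q2.
  pose proof (CT t x u v Hs) as Q3.
  pose proof (det_wave (HD t x u v Hs)) as Q4.
  cbv beta in Q1, Q2, Q3, Q4.
  assert (R3 : - 2 * rho1 * b * bpartial Bx (bpartial Bphi et) t x u v
    + rho1 * k * bpartial Bpsi et t x u v - d * (rho1 * bpartial Bt xx t x u v)
    + rho2 * k * bpartial Bphi ze t x u v = 0) by lra.
  rewrite Q4, <- Q3 in R3.
  replace (rho1 * k * bpartial Bpsi et t x u v)
    with (k * rho2 * bpartial Bphi ze t x u v) in R3
    by (replace (k * rho2 * bpartial Bphi ze t x u v)
          with (k * (rho2 * bpartial Bphi ze t x u v)) by ring;
        rewrite Q2; ring).
  replace (bpartial Bx (bpartial Bphi et) t x u v)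
    with (- bpartial Bphi ze t x u v) in R3 by lra.
  replace (- 2 * rho1 * b) with (- 2 * (k * rho2)) in R3 by (rewrite <- Hspeed; ring).
  apply (scaled_zero (d ^ 2 - 4 * k * rho2)); [exact Hdisc | lra]. }
assert (Z : forall t x u v, strip L t x ->
  bpartial Bpsi et t x u v = 0 /\ bpartial Bx tau t x u v = 0 /\
  bpartial Bt xx t x u v = 0 /\ bpartial Bx (bpartial Bphi et) t x u v = 0).
{ intros t x u v Hs.
  pose proof (CA t x u v Hs) as Q1; pose proof (CB t x u v Hs) as Q2.
  pose proof (CT t x u v Hs) as Q3.
  pose proof (det_wave (HD t x u v Hs)) as Q4.
  cbv beta in Q1, Q2, Q3, Q4; rewrite C0 in Q1, Q2, Q3 by exact Hs.
  unfold zero_bfun in *.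
  assert (T0 : bpartial Bx tau t x u v = 0) by (apply (scaled_zero k); lra).
  rewrite T0 in Q4.
  repeat split; [apply (scaled_zero rho1); lra | exact T0
                | apply (scaled_zero rho1); lra | lra]. }
split; fold et ze.
- intros i c t x u v Hs; destruct (HB t x u v Hs) as [H0 _].
  destruct i, c; try exact (H0 _ I1); try exact (H0 _ I2);
    [ exact (Tt t x u v Hs) | apply (Z t x u v Hs) | apply (Z t x u v Hs)
    | exact (Xx t x u v Hs)].
- intros t x u v Hs; apply (Z t x u v Hs).
- exact C0.
- exact AD.
- intros c t x u v Hs; destruct c.
  + exact (Eut t x u v Hs).
  + apply (Z t x u v Hs).
  + exact (det_eta_uu (HD t x u v Hs)).
  + exact (det_eta_uv (HD t x u v Hs)).
Qed.

(** * Affine vector fields *)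

Definition kron (m n : idx) : R :=
  match m, n with I1, I1 | I2, I2 => 1 | _, _ => 0 end.

Definition ext_tx (f : R -> R -> R) : bfun := fun t x _ _ => f t x.

Definition affine_in (e : R) (m : idx) (f : R -> R -> R) : bfun :=
  fun t x u v => e * bval (bu m) t x u v + f t x.

Lemma smooth_affine L e m f : smooth_tx L f -> smooth L (affine_in e m f).
Proof.
intros Hf; unfold affine_in.
apply smooth_plus with (f := fun t x u v => e * bval (bu m) t x u v); [|exact Hf].
apply smooth_mult with (f := fun _ _ _ _ => e);
  [apply smooth_const | apply smooth_coord].
Qed.

(** The difference of f and e u^m has no derivative along the fibre, hence is a
    function of (t, x), which can be read off at phi = psi = 0. *)
Lemma affine_fibres L f e m0 : smooth L f ->
  (forall m, agree L (bpartial (bu m) f) (fun _ _ _ _ => e * kron m m0)) ->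
  smooth_tx L (fun t x => f t x 0 0) /\
  agree L f (affine_in e m0 (fun t x => f t x 0 0)).
Proof.
intros Hf H.
set (w := fun t x u v => - e * bval (bu m0) t x u v).
assert (Hw : smooth L w)
  by (apply smooth_mult with (f := fun _ _ _ _ => - e);
      [apply smooth_const | apply smooth_coord]).
assert (Hh : smooth L (fun t x u v => f t x u v + w t x u v))
  by (apply smooth_plus; assumption).
assert (E : agree L (fun t x u v => f t x u v + w t x u v) (fun t x _ _ => f t x 0 0)).
{ intros t x u v Hs; cbv beta.
  transitivity (f t x 0 0 + w t x 0 0).
  - refine (fibre_const L (fun t x u v => f t x u v + w t x u v)
      (smooth_bdiff L _ Hh) _ t x u v Hs).
    intros m t' x' u' v' Hs'.
    rewrite (bpartial_plus L)
      by (exact Hs' || (apply smooth_bdiff; assumption)).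
    rewrite (H m t' x' u' v' Hs'); unfold w; rewrite bpartial_scal.
    destruct m, m0; unfold bpartial; simpl; rewrite ?Derive_id, ?Derive_const; ring.
  - unfold w; destruct m0; simpl; ring. }
split.
- apply smooth_agree with (1 := Hh); exact E.
- intros t x u v Hs; specialize (E t x u v Hs); cbv beta in E.
  unfold affine_in; unfold w in E; lra.
Qed.

Definition affine_vf (c1 c2 e : R) (f g : R -> R -> R) : vfield :=
  mkvf (cst c1) (cst c2) (affine_in e I1 f) (affine_in e I2 g).

Lemma eq_vf_agree L X Y : eq_vf L X Y ->
  (forall i, agree L (xi X i) (xi Y i)) /\ (forall m, agree L (eta X m) (eta Y m)).
Proof. intros H; split; intros i t x u v Hs; apply H, Hs. Qed.

Lemma rigid_affine L X : 0 < L -> smooth_vf L X -> rigid L X ->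
  exists c1 c2 e f g, smooth_tx L f /\ smooth_tx L g /\
    eq_vf L X (affine_vf c1 c2 e f g).
Proof.
intros HL [Hxi Heta] HX.
set (e := bpartial Bphi (eta X I1) 1 (L / 2) 0 0).
assert (He : agree L (bpartial Bphi (eta X I1)) (fun _ _ _ _ => e)).
{ apply gradient_zero_const;
    [exact HL | apply smooth_bdiff, smooth_bpartial, Heta | apply (rigid_const L X HX)]. }
destruct (affine_fibres L (eta X I1) e I1 (Heta I1)) as [Sf Ef].
{ intros [|] t x u v Hs; simpl.
  - rewrite He by exact Hs; ring.
  - rewrite (rigid_eta_v L X HX) by exact Hs; unfold zero_bfun; ring. }
destruct (affine_fibres L (eta X I2) e I2 (Heta I2)) as [Sg Eg].
{ intros [|] t x u v Hs; simpl.
  - rewrite (rigid_zeta_u L X HX) by exact Hs; unfold zero_bfun; ring.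
  - rewrite (rigid_slope L X HX), He by exact Hs; ring. }
assert (Hc : forall i, agree L (xi X i) (fun _ _ _ _ => xi X i 1 (L / 2) 0 0)).
{ intros i; apply gradient_zero_const;
    [exact HL | apply smooth_bdiff, Hxi | apply (rigid_xi L X HX)]. }
eexists _, _, e, _, _; split; [exact Sf|]; split; [exact Sg|].
intros t x u v Hs; split; intros [|].
- exact (Hc I1 t x u v Hs).
- exact (Hc I2 t x u v Hs).
- exact (Ef t x u v Hs).
- exact (Eg t x u v Hs).
Qed.

Lemma bpartial_affine L h e m f c : smooth_tx L f -> agree L h (affine_in e m f) ->
  agree L (bpartial c h)
    (fun t x u v => bpartial c (ext_tx f) t x u v
       + e * match c with Bphi => kron I1 m | Bpsi => kron I2 m | _ => 0 end).
Proof.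
intros Hf Hh t x u v Hs; rewrite (bpartial_agree L c _ _ Hh) by exact Hs.
unfold affine_in.
rewrite (bpartial_plus L c (fun t x u v => e * bval (bu m) t x u v) (ext_tx f)).
- rewrite bpartial_scal, Rplus_comm; f_equal; f_equal.
  destruct c, m; unfold bpartial; simpl; rewrite ?Derive_id, ?Derive_const; reflexivity.
- apply smooth_bdiff, smooth_mult with (f := fun _ _ _ _ => e);
    [apply smooth_const | apply smooth_coord].
- apply smooth_bdiff, Hf.
- exact Hs.
Qed.

Lemma D_affine L h e m f i p : smooth_tx L f -> agree L h (affine_in e m f) ->
  strip L (p (Jx I1)) (p (Jx I2)) ->
  D1 i h p = lift (bpartial (bx i) (ext_tx f)) p + e * p (Jd m i) /\
  D2 i h p = lift (bpartial (bx i) (bpartial (bx i) (ext_tx f))) p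
             + e * p (Jdd m (pure i)).
Proof.
intros Hf Hh Hs.
assert (F0 : forall n t x u v, bpartial (bu n) (ext_tx f) t x u v = 0)
  by (intros [|] t x u v; apply (Derive_const (f t x))).
assert (E1 : forall n, agree L (bpartial (bu n) h) (fun _ _ _ _ => e * kron n m)).
{ intros n t x u v Hs'; rewrite (bpartial_affine L h e m f _ Hf Hh) by exact Hs'.
  rewrite F0; destruct n; simpl; ring. }
assert (E0 : agree L (bpartial (bx i) h) (bpartial (bx i) (ext_tx f))).
{ intros t x u v Hs'; rewrite (bpartial_affine L h e m f _ Hf Hh) by exact Hs'.
  destruct i; simpl; ring. }
assert (L1 : forall n, lift (bpartial (bu n) h) p = e * kron n m)
  by (intros n; exact (E1 n _ _ _ _ Hs)).
assert (L2 : forall c n, lift (bpartial c (bpartial (bu n) h)) p = 0).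
{ intros c n; exact (bpartial_zero L c (e * kron n m) _ (E1 n) _ _ _ _ Hs). }
assert (L3 : lift (bpartial (bx i) h) p = lift (bpartial (bx i) (ext_tx f)) p)
  by exact (E0 _ _ _ _ Hs).
assert (L4 : lift (bpartial (bx i) (bpartial (bx i) h)) p
             = lift (bpartial (bx i) (bpartial (bx i) (ext_tx f))) p)
  by exact (bpartial_agree L _ _ _ E0 _ _ _ _ Hs).
pose proof (L2 Bphi I1) as L5; pose proof (L2 Bpsi I1) as L6;
  pose proof (L2 Bpsi I2) as L7; simpl in L5, L6, L7.
unfold D1, D2, sum2; rewrite !L2, !L1, L3, L4, L5, L6, L7.
split; destruct m; simpl; ring.
Qed.

(** What remains of the symmetry conditions of [affine_vf] once e times each equation
    is subtracted; q and r stand for psi_x and psi_xx. *)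
Definition inhomogeneity (rho1 rho2 d k : R) (chi : R -> R) (e : R)
    (f g : R -> R -> R) (t x q r : R) : Prop :=
  rho1 * Derive_n (fun s => f s x) 2 t - k * Derive_n (fun y => f t y) 2 x
    - k * Derive (fun y => g t y) x = 0
  /\
  rho2 * Derive_n (fun s => g s x) 2 t - Derive chi q * Derive_n (fun y => g t y) 2 x
    - Derive_n chi 2 q * r * (Derive (fun y => g t y) x + e * q)
    + k * (Derive (fun y => f t y) x + g t x) + d * Derive (fun s => g s x) t = 0.

(** The scaling e (phi, psi) multiplies both equations by e, up to the term
    - e chi''(q) q r caused by the nonlinearity; the other terms of [inhomogeneity] are
    the equations linearised at psi_x = q and applied to (f, g). *)
Lemma affine_admitted L rho1 rho2 d k chi c1 c2 e f g X :
  0 < rho1 -> 0 < rho2 -> (forall s, ex_derive (Derive chi) s) ->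
  smooth_tx L f -> smooth_tx L g -> eq_vf L X (affine_vf c1 c2 e f g) ->
  smooth_vf L X /\
  (admitted_by L rho1 rho2 d k chi X <->
   forall t x q r, strip L t x -> inhomogeneity rho1 rho2 d k chi e f g t x q r).
Proof.
intros Hr1 Hr2 Hc Hf Hg HX.
destruct (eq_vf_agree L _ _ HX) as [Hxi Heta].
assert (Hsm : smooth_vf L X).
{ split.
  - intros i; apply smooth_agree with (xi (affine_vf c1 c2 e f g) i);
      [destruct i; exact (smooth_const L _) | apply agree_sym, Hxi].
  - intros m; apply smooth_agree with (eta (affine_vf c1 c2 e f g) m);
      [destruct m; [exact (smooth_affine L e I1 f Hf) | exact (smooth_affine L e I2 g Hg)]
      | apply agree_sym, Heta]. }
split; [exact Hsm|].
assert (HP : forall p, strip L (p (Jx I1)) (p (Jx I2)) ->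
  prolong2 X (lhs1 rho1 k) p = e * lhs1 rho1 k p +
    (rho1 * lift (bpartial Bt (bpartial Bt (ext_tx f))) p
     - k * lift (bpartial Bx (bpartial Bx (ext_tx f))) p
     - k * lift (bpartial Bx (ext_tx g)) p) /\
  prolong2 X (lhs2 rho2 d k chi) p = e * lhs2 rho2 d k chi p +
    (rho2 * lift (bpartial Bt (bpartial Bt (ext_tx g))) p
     - Derive chi (p (Jd I2 I2)) * lift (bpartial Bx (bpartial Bx (ext_tx g))) p
     - Derive_n chi 2 (p (Jd I2 I2)) * p (Jdd I2 P22)
       * (lift (bpartial Bx (ext_tx g)) p + e * p (Jd I2 I2))
     + k * (lift (bpartial Bx (ext_tx f)) p + lift (ext_tx g) p)
     + d * lift (bpartial Bt (ext_tx g)) p)).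
{ intros p Hs.
  assert (B0 : forall i m, agree L (bpartial (bu m) (xi X i)) (fun _ _ _ _ => 0))
    by (intros i m; destruct i;
        [apply bpartial_zero with c1, (Hxi I1) | apply bpartial_zero with c2, (Hxi I2)]).
  assert (B1 : forall c i, lift (bpartial c (xi X i)) p = 0).
  { intros c [|]; [exact (bpartial_zero L c c1 _ (Hxi I1) _ _ _ _ Hs)
                  | exact (bpartial_zero L c c2 _ (Hxi I2) _ _ _ _ Hs)]. }
  assert (B2 : forall c c' i, lift (bpartial c (bpartial c' (xi X i))) p = 0).
  { intros c c' [|]; refine (bpartial_zero L c 0 _ _ _ _ _ _ Hs);
      [exact (bpartial_zero L c' c1 _ (Hxi I1))
      | exact (bpartial_zero L c' c2 _ (Hxi I2))]. }
  rewrite prolong2_lhs1, prolong2_lhs2 by apply Hc.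
  rewrite !(eta2_D2 L) by (exact Hsm || exact Hs).
  rewrite (eta1_D1 X I2 I2), (eta1_D1 X I1 I2), (eta1_D1 X I2 I1); unfold sum2.
  rewrite !(D2_base L _ (xi X _)), !(D1_base L _ (xi X _)) by (exact Hs || apply B0).
  rewrite !B1, !B2.
  assert (A1 := fun i => D_affine L _ e I1 f i p Hf (Heta I1) Hs).
  assert (A2 := fun i => D_affine L _ e I2 g i p Hg (Heta I2) Hs).
  rewrite !(fun i => proj1 (A1 i)), !(fun i => proj2 (A1 i)).
  rewrite !(fun i => proj1 (A2 i)), !(fun i => proj2 (A2 i)).
  replace (lift (eta X I2) p) with (e * p (Ju I2) + lift (ext_tx g) p)
    by (symmetry; exact (Heta I2 _ _ _ _ Hs)).
  unfold lhs1, lhs2, pure; simpl; split; ring. }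
split.
- intros H t x q r Hs.
  set (p := mkjet t x 0 0 0 0 0 q (k * q / rho1) 0 0 (Derive chi q * r / rho2) 0 r).
  destruct (HP p Hs) as [P1 P2].
  assert (Z1 : lhs1 rho1 k p = 0) by (unfold lhs1, p; simpl; field; lra).
  assert (Z2 : lhs2 rho2 d k chi p = 0) by (unfold lhs2, p; simpl; field; lra).
  destruct (H p Hs Z1 Z2) as [Q1 Q2].
  rewrite Q1, Z1 in P1; rewrite Q2, Z2 in P2.
  split.
  + rewrite Rmult_0_r, Rplus_0_l in P1; symmetry; exact P1.
  + rewrite Rmult_0_r, Rplus_0_l in P2; symmetry; exact P2.
- intros H p Hs Z1 Z2; destruct (HP p Hs) as [P1 P2].
  destruct (H _ _ (p (Jd I2 I2)) (p (Jdd I2 P22)) Hs) as [Q1 Q2].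
  rewrite Z1, Rmult_0_r, Rplus_0_l in P1; rewrite Z2, Rmult_0_r, Rplus_0_l in P2.
  split; [exact (eq_trans P1 Q1) | exact (eq_trans P2 Q2)].
Qed.

(** * The damped oscillator equation *)

Lemma locally_pos t : 0 < t -> locally t (fun s => 0 < s).
Proof. intros Ht; apply (open_gt 0 t Ht). Qed.

Lemma solves_ode_comb rho2 d k c5 c6 e5 e6 a b F G :
  solves_ode rho2 d k c5 c6 F -> solves_ode rho2 d k e5 e6 G ->
  solves_ode rho2 d k (a * c5 + b * e5) (a * c6 + b * e6) (fun t => a * F t + b * G t).
Proof.
intros HF HG; set (H := fun t => a * F t + b * G t).
assert (E1 : forall t, 0 < t -> is_derive H t (a * Derive F t + b * Derive G t)).
{ intros t Ht; destruct (HF t Ht) as [H1 _]; destruct (HG t Ht) as [H2 _].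
  exact (is_derive_plus _ _ _ _ _ (is_derive_scal F t a _ (Derive_correct _ _ H1))
           (is_derive_scal G t b _ (Derive_correct _ _ H2))). }
assert (E2 : forall t, 0 < t -> is_derive (Derive H) t
    (a * Derive (Derive F) t + b * Derive (Derive G) t)).
{ intros t Ht; destruct (HF t Ht) as [_ [H1 _]]; destruct (HG t Ht) as [_ [H2 _]].
  apply is_derive_ext_loc with (fun t => a * Derive F t + b * Derive G t).
  - apply filter_imp with (2 := locally_pos t Ht); intros s Hs.
    symmetry; apply is_derive_unique, E1, Hs.
  - exact (is_derive_plus _ _ _ _ _
             (is_derive_scal (Derive F) t a _ (Derive_correct _ _ H1))
             (is_derive_scal (Derive G) t b _ (Derive_correct _ _ H2))). }
intros t Ht; split; [eexists; exact (E1 t Ht)|]; split; [eexists; exact (E2 t Ht)|].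
change (Derive_n H 2 t) with (Derive (Derive H) t).
replace (Derive H t) with (a * Derive F t + b * Derive G t)
  by (symmetry; apply is_derive_unique, E1, Ht).
replace (Derive (Derive H) t) with (a * Derive (Derive F) t + b * Derive (Derive G) t)
  by (symmetry; apply is_derive_unique, E2, Ht).
unfold H.
destruct (HF t Ht) as [_ [_ H1]]; destruct (HG t Ht) as [_ [_ H2]].
change (Derive_n F 2 t) with (Derive (Derive F) t) in H1.
change (Derive_n G 2 t) with (Derive (Derive G) t) in H2.
apply (Rmult_eq_compat_l a) in H1; apply (Rmult_eq_compat_l b) in H2; lra.
Qed.

(** The shift A = d / k compensates the damping of the linear term. *)
Lemma solves_ode_particular rho2 d k c5 c6 A : k * A = d ->
  solves_ode rho2 d k c5 c6 (fun t => - c5 + c6 * (A - t)).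
Proof.
intros HA; set (H := fun t => - c5 + c6 * (A - t)).
assert (E1 : forall t, is_derive H t (- c6))
  by (intros t; unfold H; auto_derive; [trivial | ring]).
assert (E2 : forall t, is_derive (Derive H) t 0).
{ intros t; apply is_derive_ext with (fun _ => - c6).
  - intros s; symmetry; apply is_derive_unique, E1.
  - exact (is_derive_const (- c6) t). }
intros t Ht; split; [eexists; exact (E1 t)|]; split; [eexists; exact (E2 t)|].
change (Derive_n H 2 t) with (Derive (Derive H) t).
replace (Derive H t) with (- c6) by (symmetry; apply is_derive_unique, E1).
replace (Derive (Derive H) t) with 0 by (symmetry; apply is_derive_unique, E2).
unfold H; rewrite <- HA; ring.
Qed.

Definition wronskian (F G : R -> R) (t : R) : R := F t * Derive G t - Derive F t * G t.

(** Abel's identity. *)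
Lemma wronskian_derive rho2 d k F G t : 0 < rho2 ->
  solves_ode rho2 d k 0 0 F -> solves_ode rho2 d k 0 0 G -> 0 < t ->
  is_derive (wronskian F G) t (- (d / rho2) * wronskian F G t).
Proof.
intros Hr HF HG Ht; destruct (HF t Ht) as [F1 [F2 F3]].
destruct (HG t Ht) as [G1 [G2 G3]].
change (Derive_n F 2 t) with (Derive (Derive F) t) in F3.
change (Derive_n G 2 t) with (Derive (Derive G) t) in G3.
evar (l : R); assert (H : is_derive (wronskian F G) t l).
{ apply (is_derive_minus (fun t => F t * Derive G t) (fun t => Derive F t * G t)).
  - apply (is_derive_mult F (Derive G) t _ _ (Derive_correct _ _ F1)
             (Derive_correct _ _ G2)); intros; apply Rmult_comm.
  - apply (is_derive_mult (Derive F) G t _ _ (Derive_correct _ _ F2)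
             (Derive_correct _ _ G1)); intros; apply Rmult_comm. }
replace (- (d / rho2) * wronskian F G t) with l; [exact H|].
unfold l, wronskian, minus, plus, mult, opp; simpl.
apply (Rmult_eq_reg_l rho2); [|lra].
replace (rho2 * (- (d / rho2) * (F t * Derive G t - Derive F t * G t)))
  with (- d * (F t * Derive G t - Derive F t * G t)) by (field; lra).
apply (Rmult_eq_compat_l (G t)) in F3; apply (Rmult_eq_compat_l (F t)) in G3.
lra.
Qed.

Lemma wronskian_ratio rho2 d k F G h1 h2 : 0 < rho2 ->
  solves_ode rho2 d k 0 0 F -> solves_ode rho2 d k 0 0 G ->
  solves_ode rho2 d k 0 0 h1 -> solves_ode rho2 d k 0 0 h2 ->
  (forall t, 0 < t -> wronskian h1 h2 t <> 0) ->
  forall t, 0 < t -> wronskian F G t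
    = wronskian F G 1 / wronskian h1 h2 1 * wronskian h1 h2 t.
Proof.
intros Hr HF HG H1 H2 HW t Ht.
assert (E : wronskian F G t / wronskian h1 h2 t = wronskian F G 1 / wronskian h1 h2 1).
{ apply (null_derive_const (fun t => wronskian F G t / wronskian h1 h2 t)).
  intros s Hs; assert (Hs0 : 0 < s).
  { apply Rlt_le_trans with (2 := proj1 Hs); apply Rmin_glb_lt; lra. }
  assert (D1 := wronskian_derive rho2 d k F G s Hr HF HG Hs0).
  assert (D2 := wronskian_derive rho2 d k h1 h2 s Hr H1 H2 Hs0).
  assert (D3 := is_derive_div _ _ s _ _ D1 D2 (HW s Hs0)).
  split; [eexists; exact D3|].
  rewrite (is_derive_unique _ _ _ D3).
  unfold minus, plus, mult, opp, scal; simpl; field; split; [lra | apply HW, Hs0]. }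
rewrite <- E; field; apply HW, Ht.
Qed.

(** Cramer's rule G W(h1, h2) = h1 W(G, h2) + h2 W(h1, G), with both quotients of
    Wronskians constant by [wronskian_ratio]. *)
Lemma fundamental_span rho2 d k h1 h2 G : 0 < rho2 ->
  solves_ode rho2 d k 0 0 h1 -> solves_ode rho2 d k 0 0 h2 ->
  (forall t, 0 < t -> wronskian h1 h2 t <> 0) -> solves_ode rho2 d k 0 0 G ->
  exists a b, forall t, 0 < t -> G t = a * h1 t + b * h2 t.
Proof.
intros Hr H1 H2 HW HG.
exists (wronskian G h2 1 / wronskian h1 h2 1), (wronskian h1 G 1 / wronskian h1 h2 1).
intros t Ht.
assert (Ea := wronskian_ratio rho2 d k G h2 h1 h2 Hr HG H2 H1 H2 HW t Ht).
assert (Eb := wronskian_ratio rho2 d k h1 G h1 h2 Hr H1 HG H1 H2 HW t Ht).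
apply (Rmult_eq_reg_r (wronskian h1 h2 t)); [|apply HW, Ht].
transitivity (h1 t * wronskian G h2 t + h2 t * wronskian h1 G t);
  [unfold wronskian; ring | rewrite Ea, Eb; ring].
Qed.

Lemma fundamental_independent rho2 d k h1 h2 a b :
  solves_ode rho2 d k 0 0 h1 -> solves_ode rho2 d k 0 0 h2 ->
  wronskian h1 h2 1 <> 0 -> (forall t, 0 < t -> a * h1 t + b * h2 t = 0) ->
  a = 0 /\ b = 0.
Proof.
intros H1 H2 HW H.
assert (E0 := H 1 Rlt_0_1).
assert (E1 : a * Derive h1 1 + b * Derive h2 1 = 0).
{ destruct (H1 1 Rlt_0_1) as [D1 _]; destruct (H2 1 Rlt_0_1) as [D2 _].
  transitivity (Derive (fun t => a * h1 t + b * h2 t) 1).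
  - rewrite Derive_plus by (apply ex_derive_scal; assumption).
    rewrite !Derive_scal; reflexivity.
  - transitivity (Derive (fun _ => 0) 1); [|exact (Derive_const 0 1)].
    apply Derive_ext_loc, filter_imp with (2 := locally_pos 1 Rlt_0_1); exact H. }
unfold wronskian in HW; split; apply (scaled_zero _ _ HW).
- replace ((h1 1 * Derive h2 1 - Derive h1 1 * h2 1) * a)
    with ((a * h1 1 + b * h2 1) * Derive h2 1
          - (a * Derive h1 1 + b * Derive h2 1) * h2 1) by ring.
  rewrite E0, E1; ring.
- replace ((h1 1 * Derive h2 1 - Derive h1 1 * h2 1) * b)
    with ((a * Derive h1 1 + b * Derive h2 1) * h1 1
          - (a * h1 1 + b * h2 1) * Derive h1 1) by ring.
  rewrite E0, E1; ring.
Qed.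

(** This family is closed under differentiation when C' = q S and S' = r C, so its
    second derivative needs no separate computation. *)
Definition damped (al : R) (C S : R -> R) (a b t : R) : R :=
  exp (- al * t) * (a * C t + b * S t).

Lemma damped_derive al q r C S a b :
  (forall t, is_derive C t (q * S t)) -> (forall t, is_derive S t (r * C t)) ->
  forall t, is_derive (damped al C S a b) t
              (damped al C S (- al * a + r * b) (q * a - al * b) t).
Proof.
intros HC HS t; unfold damped.
assert (DC : ex_derive C t) by (eexists; apply HC).
assert (DS : ex_derive S t) by (eexists; apply HS).
auto_derive; [tauto|].
replace (Derive (fun x => C x) t) with (q * S t)
  by (symmetry; apply is_derive_unique, HC).
replace (Derive (fun x => S x) t) with (r * C t)
  by (symmetry; apply is_derive_unique, HS).
ring.
Qed.

(** The hypotheses on al and q r are Vieta's relations for the characteristic roots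
    - al +- sqrt (q r); the Wronskian is exp (- al t)^2 (r C^2 - q S^2). *)
Lemma damped_fundamental rho2 d k al q r C S :
  (forall t, is_derive C t (q * S t)) -> (forall t, is_derive S t (r * C t)) ->
  d = 2 * rho2 * al -> k = rho2 * (al ^ 2 - q * r) ->
  (forall t, r * C t ^ 2 - q * S t ^ 2 <> 0) ->
  solves_ode rho2 d k 0 0 (damped al C S 1 0) /\
  solves_ode rho2 d k 0 0 (damped al C S 0 1) /\
  forall t, wronskian (damped al C S 1 0) (damped al C S 0 1) t <> 0.
Proof.
intros HC HS Hd Hk HW.
assert (D := damped_derive al q r C S).
assert (E : forall a b, Derive (damped al C S a b)
                        = damped al C S (- al * a + r * b) (q * a - al * b)).
{ intros a b; apply functional_extensionality; intros t.
  apply is_derive_unique, D; assumption. }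
assert (Sol : forall a b, solves_ode rho2 d k 0 0 (damped al C S a b)).
{ intros a b t _; split; [eexists; apply D; assumption|].
  change (Derive_n (damped al C S a b) 2 t)
    with (Derive (Derive (damped al C S a b)) t).
  rewrite E; split; [eexists; apply D; assumption|].
  rewrite E, Hd, Hk; unfold damped; ring. }
split; [apply Sol|]; split; [apply Sol|].
intros t; unfold wronskian; rewrite !E.
replace (damped al C S 1 0 t * damped al C S (- al * 0 + r * 1) (q * 0 - al * 1) t
         - damped al C S (- al * 1 + r * 0) (q * 1 - al * 0) t * damped al C S 0 1 t)
  with (exp (- al * t) ^ 2 * (r * C t ^ 2 - q * S t ^ 2)) by (unfold damped; ring).
apply Rmult_integral_contrapositive_currified; [|apply HW].
apply pow_nonzero, Rgt_not_eq, exp_pos.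
Qed.

Definition nonlinear_basis (A : R) (h1 h2 : R -> R) : list vfield :=
  [X1; X2; X3; X4; X5; X6 A; dpsi h1; dpsi h2].

Lemma lincomb_basis a1 a2 a3 a4 a5 a6 a7 a8 A h1 h2 L :
  eq_vf L (lincomb [a1; a2; a3; a4; a5; a6; a7; a8] (nonlinear_basis A h1 h2))
    (mkvf (fun _ _ _ _ => a1) (fun _ _ _ _ => a2)
       (fun t x _ _ => a3 + a4 * t + a5 * x + a6 * t * x)
       (fun t _ _ _ => - a5 + a6 * (A - t) + (a7 * h1 t + a8 * h2 t))).
Proof. intros t x u v _; split; intros [|]; simpl; unfold cst; ring. Qed.

Lemma eq_vf_trans L X Y Z : eq_vf L X Y -> eq_vf L Y Z -> eq_vf L X Z.
Proof.
intros H1 H2 t x u v Hs; destruct (H1 t x u v Hs) as [A1 B1].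
destruct (H2 t x u v Hs) as [A2 B2].
split; intros i; [rewrite A1; apply A2 | rewrite B1; apply B2].
Qed.

Lemma eq_vf_sym L X Y : eq_vf L X Y -> eq_vf L Y X.
Proof.
intros H t x u v Hs; destruct (H t x u v Hs) as [A B].
split; intros i; symmetry; auto.
Qed.

Lemma nonlinear_form_basis L rho2 d k (P : vfield -> Prop) A h1 h2 :
  0 < L -> 0 < rho2 -> k * A = d ->
  (forall X, P X <-> nonlinear_form L rho2 d k X) ->
  solves_ode rho2 d k 0 0 h1 -> solves_ode rho2 d k 0 0 h2 ->
  (forall t, 0 < t -> wronskian h1 h2 t <> 0) ->
  is_basis L P (nonlinear_basis A h1 h2).
Proof.
intros HL Hr HA HP H1 H2 HW.
assert (Len : forall a : list R, length a = 8%nat -> exists a1 a2 a3 a4 a5 a6 a7 a8,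
  a = [a1; a2; a3; a4; a5; a6; a7; a8]).
{ intros a Ha; do 8 (destruct a as [|? a]; [discriminate|]).
  destruct a; [|discriminate]; do 8 eexists; reflexivity. }
split.
- intros a Ha HE c Hc; destruct (Len a Ha) as (a1&a2&a3&a4&a5&a6&a7&a8&->).
  assert (E := eq_vf_trans _ _ _ _ (eq_vf_sym _ _ _
    (lincomb_basis a1 a2 a3 a4 a5 a6 a7 a8 A h1 h2 L)) HE).
  assert (Hst : forall t, 0 < t -> strip L t (L / 2) /\ strip L t (L / 4))
    by (intros t Ht; unfold strip; lra).
  (* Four points of the strip separate the monomials 1, t, x, t x. *)
  destruct (E 1 (L / 2) 0 0) as [G1 G2]; [apply Hst; lra|].
  destruct (E 1 (L / 4) 0 0) as [_ G3]; [apply Hst; lra|].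
  destruct (E 2 (L / 2) 0 0) as [_ G4]; [apply Hst; lra|].
  destruct (E 2 (L / 4) 0 0) as [_ G5]; [apply Hst; lra|].
  assert (Z1 := G1 I1); assert (Z2 := G1 I2); assert (Y1 := G2 I1).
  assert (Y2 := G3 I1); assert (Y3 := G4 I1); assert (Y4 := G5 I1).
  simpl in Z1, Z2, Y1, Y2, Y3, Y4.
  assert (Z6 : a6 = 0) by (apply (scaled_zero L); lra).
  rewrite Z6 in Y1, Y2, Y3, Y4.
  assert (Z5 : a5 = 0) by (apply (scaled_zero L); lra).
  assert (Z4 : a4 = 0) by lra.
  assert (Z3 : a3 = 0) by (rewrite Z5, Z4 in Y1; lra).
  destruct (fundamental_independent rho2 d k h1 h2 a7 a8 H1 H2 (HW 1 Rlt_0_1))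
    as [Z7 Z8].
  { intros t Ht; destruct (E t (L / 2) 0 0) as [_ G]; [apply Hst, Ht|].
    specialize (G I2); simpl in G; rewrite Z5, Z6 in G; lra. }
  simpl in Hc; intuition congruence.
- intros X; rewrite HP; split.
  + intros (c1 & c2 & c3 & c4 & c5 & c6 & F & HF & HX).
    assert (HG := solves_ode_comb rho2 d k c5 c6 c5 c6 1 (-1) _ _ HF
                    (solves_ode_particular rho2 d k c5 c6 A HA)).
    replace (1 * c5 + -1 * c5) with 0 in HG by ring.
    replace (1 * c6 + -1 * c6) with 0 in HG by ring.
    destruct (fundamental_span rho2 d k h1 h2 _ Hr H1 H2 HW HG) as (a7 & a8 & HS).
    exists [c1; c2; c3; c4; c5; c6; a7; a8]; split; [reflexivity|].
    eapply eq_vf_trans; [exact HX|]; apply eq_vf_sym.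
    eapply eq_vf_trans; [apply lincomb_basis|].
    intros t x u v Hs; split; intros [|]; simpl; trivial.
    rewrite <- (HS t (proj1 Hs)); ring.
  + intros (a & Ha & HX); destruct (Len a Ha) as (a1&a2&a3&a4&a5&a6&a7&a8&->).
    exists a1, a2, a3, a4, a5, a6,
      (fun t => 1 * (- a5 + a6 * (A - t)) + 1 * (a7 * h1 t + a8 * h2 t)); split.
    * assert (HG := solves_ode_comb rho2 d k a5 a6 _ _ 1 1 _ _
        (solves_ode_particular rho2 d k a5 a6 A HA)
        (solves_ode_comb rho2 d k 0 0 0 0 a7 a8 h1 h2 H1 H2)).
      replace (1 * a5 + 1 * (a7 * 0 + a8 * 0)) with a5 in HG by ring.
      replace (1 * a6 + 1 * (a7 * 0 + a8 * 0)) with a6 in HG by ring.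
      exact HG.
    * eapply eq_vf_trans; [exact HX|]; eapply eq_vf_trans; [apply lincomb_basis|].
      intros t x u v _; split; intros [|]; simpl; ring.
Qed.

(** * The classification *)

Lemma continuous_time L F : (forall t, 0 < t -> ex_derive F t) ->
  continuous_on_strip L (ext_tx (fun t _ => F t)).
Proof.
intros HF t x u v Hs.
refine (continuous_comp (fun q : R * R * R * R => fst (fst (fst q))) F (t, x, u, v) _ _).
- exact (Ck_coord L 0 Bt t x u v Hs).
- exact (ex_derive_continuous F t (HF t (proj1 Hs))).
Qed.

Lemma Ck_time_S L n F : (forall t, 0 < t -> ex_derive F t) ->
  Ck L n (ext_tx (fun t _ => Derive F t)) -> Ck L (S n) (ext_tx (fun t _ => F t)).
Proof.
intros HF HD; apply Ck_S_intro; [apply continuous_time, HF | |].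
- intros [| | |] t x u v [Ht _];
    [exact (HF t Ht) | apply ex_derive_const | apply ex_derive_const
    | apply ex_derive_const].
- intros [| | |]; [exact HD | | | ];
    (apply Ck_agree with (fun _ _ _ _ => 0); [apply Ck_const|];
     intros t x u v _; symmetry; exact (Derive_const (F t) _)).
Qed.

(** Bootstrap: the equation expresses F'' through t, F' and F, so F and F' gain one
    order of differentiability together. *)
Lemma solves_ode_smooth L rho2 d k c5 c6 F : 0 < rho2 ->
  solves_ode rho2 d k c5 c6 F -> smooth_tx L (fun t _ => F t).
Proof.
intros Hr HF.
assert (H : forall n, Ck L n (ext_tx (fun t _ => F t)) /\
                      Ck L n (ext_tx (fun t _ => Derive F t))).
{ assert (D1 : forall t, 0 < t -> ex_derive F t) by (intros t Ht; apply HF, Ht).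
  assert (D2 : forall t, 0 < t -> ex_derive (Derive F) t) by (intros t Ht; apply HF, Ht).
  assert (Step : forall n, Ck L n (ext_tx (fun t _ => Derive (Derive F) t)) ->
    Ck L (S n) (ext_tx (fun t _ => F t)) /\ Ck L (S n) (ext_tx (fun t _ => Derive F t))).
  { intros n Hn.
    assert (H1 : Ck L (S n) (ext_tx (fun t _ => Derive F t)))
      by (apply Ck_time_S; assumption).
    split; [|exact H1]; apply Ck_time_S; [exact D1 | apply Ck_pred, H1]. }
  assert (Second : forall n, Ck L n (ext_tx (fun t _ => F t)) ->
    Ck L n (ext_tx (fun t _ => Derive F t)) ->
    Ck L n (ext_tx (fun t _ => Derive (Derive F) t))).
  { intros n H0 H1.
    assert (Lin : forall a c f, Ck L n f -> Ck L n (fun t x u v => a + c * f t x u v)).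
    { intros a c f Hf; apply Ck_plus with (f := fun _ _ _ _ => a); [apply Ck_const|].
      apply Ck_mult with (f := fun _ _ _ _ => c); [apply Ck_const | exact Hf]. }
    apply Ck_agree with (fun t x u v =>
      (- c5 * k / rho2 + - (c6 * k / rho2) * bval Bt t x u v)
      + ((0 + - (d / rho2) * ext_tx (fun t _ => Derive F t) t x u v)
         + (0 + - (k / rho2) * ext_tx (fun t _ => F t) t x u v))).
    - apply Ck_plus; [apply Lin, Ck_coord|].
      apply Ck_plus; apply Lin; assumption.
    - intros t x u v [Ht _]; destruct (HF t Ht) as [_ [_ E]].
      change (Derive_n F 2 t) with (Derive (Derive F) t) in E.
      unfold ext_tx; simpl.
      apply (Rmult_eq_reg_l rho2); [|lra].
      transitivity (- c6 * k * t - c5 * k - d * Derive F t - k * F t);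
        [field; lra | lra]. }
  induction n as [|n IH].
  - split; apply continuous_time; assumption.
  - apply Step, Second; apply IH. }
intros n; apply H.
Qed.

Lemma solves_linear_inhomogeneity L rho1 rho2 d k b chi e f g :
  (forall q, Derive chi q = b) -> (forall q, Derive_n chi 2 q = 0) ->
  (solves_linear L rho1 rho2 d k b f g <->
   forall t x q r, strip L t x -> inhomogeneity rho1 rho2 d k chi e f g t x q r).
Proof.
intros H1 H2; split.
- intros H t x q r Hs; destruct (H t x Hs) as [E1 E2]; split.
  + exact E2.
  + rewrite H1, H2; lra.
- intros H t x Hs; destruct (H t x 0 0 Hs) as [E1 E2].
  rewrite H1, H2 in E2; split; lra.
Qed.

(** A second point near s, by continuity of chi''; two points are needed to conclude
    from g_x + e q = 0. *)
Lemma second_derivative_witness (chi : R -> R) (s : R) :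
  (forall n s, ex_derive_n chi n s) -> Derive_n chi 2 s <> 0 ->
  exists s', s' <> s /\ Derive_n chi 2 s' <> 0.
Proof.
intros Hchi Hs.
assert (HC : continuous (Derive_n chi 2) s)
  by exact (ex_derive_continuous (Derive_n chi 2) s (Hchi 3%nat s)).
destruct (proj1 (filterlim_locally _ _) HC
            (mkposreal _ (Rabs_pos_lt _ Hs))) as [e He].
exists (s + e / 2); pose proof (cond_pos e); split; [lra|].
intros Z; specialize (He (s + e / 2)).
assert (HB : ball s e (s + e / 2)).
{ change (Rabs (s + e / 2 - s) < e); rewrite Rabs_right; lra. }
apply He in HB; change (Rabs (Derive_n chi 2 (s + e / 2) - Derive_n chi 2 s)
                        < Rabs (Derive_n chi 2 s)) in HB.
rewrite Z, Rminus_0_l, Rabs_Ropp in HB; lra.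
Qed.

Lemma nonconstant_speed (chi : R -> R) (a c s : R) : a <> 0 ->
  Derive_n chi 2 s <> 0 -> exists p, a * Derive chi p <> c.
Proof.
intros Ha Hs; apply NNPP; intros HN; apply Hs.
assert (E : forall p, Derive chi p = c / a).
{ intros p; apply (Rmult_eq_reg_l a); [|exact Ha].
  transitivity c; [|field; exact Ha].
  apply NNPP; intros Hp; apply HN; exists p; exact Hp. }
change (Derive (Derive chi) s = 0).
rewrite (Derive_ext (Derive chi) (fun _ => c / a) s E); apply Derive_const.
Qed.

Lemma affine_of_null_second_derivative (h : R -> R) (s0 : R) (P : R -> Prop) :
  P s0 -> (forall a b s, P a -> P b -> Rmin a b <= s <= Rmax a b -> P s) ->
  (forall s, P s -> ex_derive h s /\ ex_derive (Derive h) s /\ Derive (Derive h) s = 0) ->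
  forall s, P s -> h s = h s0 + Derive h s0 * (s - s0).
Proof.
intros H0 HP H.
assert (E : forall s, P s -> Derive h s = Derive h s0).
{ intros s Hs; apply null_derive_const; intros r Hr; apply H, (HP s s0); assumption. }
intros s Hs.
assert (E2 : h s - Derive h s0 * s = h s0 - Derive h s0 * s0).
{ apply (null_derive_const (fun r => h r - Derive h s0 * r)); intros r Hr.
  assert (Hr' := HP s s0 r Hs H0 Hr).
  assert (D : is_derive (fun r => h r - Derive h s0 * r) r (Derive h r - Derive h s0)).
  { destruct (H r Hr') as [Hd _]; auto_derive; [exact Hd|].
    change (Derive (fun x => h x)) with (Derive h); ring. }
  split; [eexists; exact D|].
  refine (eq_trans (is_derive_unique _ _ _ D) _); rewrite E by exact Hr'; apply Rminus_diag. }
lra.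
Qed.

(** With e = 0 and g = F(t), the second condition reads k f_x = - (rho2 F'' + d F' + k F),
    a function of t alone, and the first one f_tt = 0.  Hence f is affine in x and in
    t separately; its slope in x is recovered from the two lines x = L/2, L/4. *)
Lemma nonlinear_affine_form L rho1 rho2 d k chi c1 c2 e f g s X :
  0 < L -> 0 < rho1 -> 0 < k -> (forall n s, ex_derive_n chi n s) ->
  Derive_n chi 2 s <> 0 -> smooth_tx L f -> smooth_tx L g ->
  eq_vf L X (affine_vf c1 c2 e f g) ->
  (forall t x q r, strip L t x -> inhomogeneity rho1 rho2 d k chi e f g t x q r) ->
  nonlinear_form L rho2 d k X.
Proof.
intros HL Hr1 Hk Hchi Hs Hf Hg HX HI.
destruct (second_derivative_witness chi s Hchi Hs) as [s' [Hne Hs']].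
(* Subtracting the equation at r = 0 isolates the coefficient of psi_xx. *)
assert (HG : forall t x q, strip L t x -> Derive_n chi 2 q <> 0 ->
          Derive (fun y => g t y) x + e * q = 0).
{ intros t x q Hst Hq; destruct (HI t x q 0 Hst) as [_ E0].
  destruct (HI t x q 1 Hst) as [_ E1]; apply (scaled_zero _ _ Hq); lra. }
assert (Hst : forall t, 0 < t -> strip L t (L / 2) /\ strip L t (L / 4))
  by (intros t Ht; unfold strip; lra).
assert (He : e = 0).
{ pose proof (HG 1 (L / 2) s (proj1 (Hst 1 Rlt_0_1)) Hs) as E1.
  pose proof (HG 1 (L / 2) s' (proj1 (Hst 1 Rlt_0_1)) Hs') as E2.
  apply (scaled_zero (s' - s)); lra. }
assert (Hgx : agree L (bpartial Bx (ext_tx g)) (fun _ _ _ _ => 0)).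
{ intros t x u v H; change (Derive (fun y => g t y) x = 0).
  pose proof (HG t x s H Hs) as E1; rewrite He in E1; lra. }
set (F := fun t => g t (L / 2)).
assert (HgF : agree L (ext_tx g) (ext_tx (fun t _ => F t))).
{ intros t x u v H.
  exact (bslice_const L _ Bx (smooth_bdiff L _ Hg) Hgx t x 0 0 t (L / 2) 0 0 H
           (proj1 (Hst t (proj1 H)))). }
set (H := fun t => - (rho2 * Derive_n F 2 t + d * Derive F t + k * F t) / k).
assert (Hfx : agree L (bpartial Bx (ext_tx f)) (ext_tx (fun t _ => H t))).
{ intros t x u v Hst'; destruct (HI t x 0 0 Hst') as [_ E].
  assert (Gt : Derive (fun r => g r x) t = Derive F t)
    by exact (bpartial_agree L Bt _ _ HgF t x 0 0 Hst').
  assert (Gtt : Derive_n (fun r => g r x) 2 t = Derive_n F 2 t)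
    by exact (bpartial_agree L Bt _ _ (bpartial_agree L Bt _ _ HgF) t x 0 0 Hst').
  assert (Gxx : Derive_n (fun y => g t y) 2 x = 0)
    by exact (bpartial_zero L Bx 0 _ Hgx t x 0 0 Hst').
  assert (G0 : g t x = F t) by exact (HgF t x 0 0 Hst').
  rewrite Gt, Gtt, Gxx, G0 in E.
  change (Derive (fun y => f t y) x = H t); unfold H.
  apply (Rmult_eq_reg_l k); [|lra].
  transitivity (- (rho2 * Derive_n F 2 t + d * Derive F t + k * F t));
    [lra | field; lra]. }
assert (Hfxx : agree L (bpartial Bx (bpartial Bx (ext_tx f))) (fun _ _ _ _ => 0)).
{ intros t x u v Hst'; rewrite (bpartial_agree L Bx _ _ Hfx) by exact Hst'.
  exact (Derive_const (H t) x). }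
assert (Hftt : agree L (bpartial Bt (bpartial Bt (ext_tx f))) (fun _ _ _ _ => 0)).
{ intros t x u v Hst'; destruct (HI t x 0 0 Hst') as [E _].
  assert (E1 : Derive (fun y => g t y) x = 0) by exact (Hgx t x 0 0 Hst').
  assert (E2 : Derive_n (fun y => f t y) 2 x = 0) by exact (Hfxx t x 0 0 Hst').
  rewrite E1, E2 in E; change (Derive_n (fun r => f r x) 2 t = 0).
  apply (scaled_zero rho1); lra. }
assert (Df := smooth_bdiff L _ Hf).
assert (Df1 : forall c, bdiff L (bpartial c (ext_tx f)))
  by (intros c; apply smooth_bdiff, smooth_bpartial, Hf).
assert (Af : forall t x, strip L t x ->
  f t x = f t (L / 2) + H t * (x - L / 2)).
{ intros t x Hst'.
  rewrite (affine_of_null_second_derivative (fun y => f t y) (L / 2)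
             (fun y => strip L t y)).
  - f_equal; f_equal; exact (Hfx t (L / 2) 0 0 (proj1 (Hst t (proj1 Hst')))).
  - apply Hst, Hst'.
  - intros a b y [_ Ha] [_ Hb]; unfold strip, Rmin, Rmax.
    destruct (Rle_dec a b); destruct Hst'; lra.
  - intros y Hy; split; [exact (Df Bx t y 0 0 Hy)|]; split;
      [exact (Df1 Bx Bx t y 0 0 Hy) | exact (Hfxx t y 0 0 Hy)].
  - exact Hst'. }
assert (At : forall t x, 0 < t -> 0 < x < L ->
  f t x = f 1 x + Derive (fun r => f r x) 1 * (t - 1)).
{ intros t x Ht Hx.
  apply (affine_of_null_second_derivative (fun r => f r x) 1 (fun r => 0 < r));
    [lra | | | exact Ht].
  - intros a b y Ha Hb; unfold Rmin; destruct (Rle_dec a b); lra.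
  - intros r Hr; split; [exact (Df Bt r x 0 0 (conj Hr Hx))|]; split;
      [exact (Df1 Bt Bt r x 0 0 (conj Hr Hx)) | exact (Hftt r x 0 0 (conj Hr Hx))]. }
(* H (t) L / 4 = f (t, L/2) - f (t, L/4), where both values are affine in t. *)
set (a0 := f 1 (L / 2)); set (b0 := Derive (fun r => f r (L / 2)) 1).
set (a1 := f 1 (L / 4)); set (b1 := Derive (fun r => f r (L / 4)) 1).
set (c6 := 4 / L * (b0 - b1)); set (c5 := 4 / L * (a0 - a1) - c6).
assert (HH : forall t, 0 < t -> H t = c5 + c6 * t).
{ intros t Ht; pose proof (Af t (L / 4) (proj2 (Hst t Ht))) as E.
  rewrite (At t (L / 4)), (At t (L / 2)) in E by lra.
  fold a0 b0 a1 b1 in E.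
  apply (Rmult_eq_reg_l (L / 4)); [|lra].
  transitivity (a0 + b0 * (t - 1) - (a1 + b1 * (t - 1))); [lra|].
  unfold c5, c6; field; lra. }
exists c1, c2, (a0 - b0 - c5 * (L / 2)), (b0 - c6 * (L / 2)), c5, c6, F; split.
- intros t Ht; split.
  + exact (smooth_bdiff L _ Hg Bt t (L / 2) 0 0 (proj1 (Hst t Ht))).
  + split.
    * exact (smooth_bdiff L _ (smooth_bpartial L Bt _ Hg) Bt t (L / 2) 0 0
               (proj1 (Hst t Ht))).
    * pose proof (HH t Ht) as E; apply (Rmult_eq_compat_l k) in E.
      replace (k * H t)
        with (- (rho2 * Derive_n F 2 t + d * Derive F t + k * F t)) in E
        by (unfold H; field; lra).
      lra.
- eapply eq_vf_trans; [exact HX|].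
  intros t x u v Hst'; split; intros [|]; simpl; trivial; unfold affine_in; rewrite He.
  + rewrite (Af t x Hst'), (HH t (proj1 Hst')).
    rewrite (At t (L / 2)) by (destruct Hst'; lra); fold a0 b0; ring.
  + rewrite Rmult_0_l, Rplus_0_l; exact (HgF t x u v Hst').
Qed.

Lemma nonlinear_form_affine L rho1 rho2 d k chi X :
  0 < rho2 -> nonlinear_form L rho2 d k X ->
  exists c1 c2 f g, smooth_tx L f /\ smooth_tx L g /\
    eq_vf L X (affine_vf c1 c2 0 f g) /\
    forall t x q r, strip L t x -> inhomogeneity rho1 rho2 d k chi 0 f g t x q r.
Proof.
intros Hr2 (c1 & c2 & c3 & c4 & c5 & c6 & F & HF & HX).
set (f := fun t x => c3 + c4 * t + c5 * x + c6 * t * x).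
exists c1, c2, f, (fun t _ => F t); split; [|split; [|split]].
- assert (Hm : forall a h, smooth L h -> smooth L (fun t x u v => a * h t x u v))
    by (intros a h Hh; apply smooth_mult with (f := fun _ _ _ _ => a);
        [apply smooth_const | exact Hh]).
  apply smooth_agree with (fun t x u v => c3 + (c4 * bval Bt t x u v
    + (c5 * bval Bx t x u v + c6 * (bval Bt t x u v * bval Bx t x u v)))).
  + apply smooth_plus with (f := fun _ _ _ _ => c3); [apply smooth_const|].
    apply smooth_plus; [apply Hm, smooth_coord|].
    apply smooth_plus; apply Hm; [apply smooth_coord|].
    apply smooth_mult; apply smooth_coord.
  + intros t x u v _; unfold f; simpl; ring.
- exact (solves_ode_smooth L rho2 d k c5 c6 F Hr2 HF).
- eapply eq_vf_trans; [exact HX|].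
  intros t x u v _; split; intros [|]; simpl; unfold affine_in, f; try ring; reflexivity.
- intros t x q r H; split.
  + assert (Ft : forall t, Derive (fun s => f s x) t = c4 + c6 * x)
      by (intros s; unfold f; apply is_derive_unique; auto_derive; [trivial | ring]).
    assert (Fx : forall x, Derive (fun y => f t y) x = c5 + c6 * t)
      by (intros y; unfold f; apply is_derive_unique; auto_derive; [trivial | ring]).
    change (rho1 * Derive (Derive (fun s => f s x)) t
      - k * Derive (Derive (fun y => f t y)) x - k * Derive (fun _ => F t) x = 0).
    rewrite (Derive_ext _ _ t Ft), (Derive_ext _ _ x Fx), !Derive_const; ring.
  + assert (Fx : Derive (fun y => f t y) x = c5 + c6 * t)
      by (unfold f; apply is_derive_unique; auto_derive; [trivial | ring]).
    destruct (HF t (proj1 H)) as [_ [_ E]].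
    assert (Gx : forall y, Derive (fun _ : R => F t) y = 0) by (intros y; apply Derive_const).
    assert (Gxx : Derive_n (fun _ : R => F t) 2 x = 0).
    { change (Derive (Derive (fun _ => F t)) x = 0).
      rewrite (Derive_ext _ _ x Gx); apply Derive_const. }
    rewrite Fx, Gx, Gxx.
    change (Derive_n (fun s => F s) 2 t) with (Derive_n F 2 t).
    change (Derive (fun s => F s) t) with (Derive F t).
    lra.
Qed.

Lemma is_derive_scaled (h h' : R -> R) c m t : m <> 0 ->
  (forall y, derivable_pt_lim h y (h' y)) ->
  is_derive (fun t => h (c * t / m)) t (c / m * h' (c * t / m)).
Proof.
intros Hm Hh.
refine (is_derive_comp h (fun t => c * t / m) t _ (c / m) _ _).
- apply is_derive_Reals, Hh.
- auto_derive; [trivial | field; exact Hm].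
Qed.

Lemma nonneg_square_eq x y : 0 <= x -> 0 <= y -> x ^ 2 = y ^ 2 -> x = y.
Proof. intros Hx Hy H; apply Rsqr_inj; trivial; unfold Rsqr; lra. Qed.

Lemma damped_basis L rho2 d k (P : vfield -> Prop) A al q r C S h1 h2 :
  0 < L -> 0 < rho2 -> k * A = d ->
  (forall X, P X <-> nonlinear_form L rho2 d k X) ->
  (forall t, is_derive C t (q * S t)) -> (forall t, is_derive S t (r * C t)) ->
  d = 2 * rho2 * al -> k = rho2 * (al ^ 2 - q * r) ->
  (forall t, r * C t ^ 2 - q * S t ^ 2 <> 0) ->
  (forall t, h1 t = exp (- al * t) * C t) -> (forall t, h2 t = exp (- al * t) * S t) ->
  is_basis L P [X1; X2; X3; X4; X5; X6 A; dpsi h1; dpsi h2].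
Proof.
intros HL Hr HA HP HC HS Hd Hk HW E1 E2.
assert (F1 : h1 = damped al C S 1 0)
  by (apply functional_extensionality; intros t; rewrite E1; unfold damped; ring).
assert (F2 : h2 = damped al C S 0 1)
  by (apply functional_extensionality; intros t; rewrite E2; unfold damped; ring).
destruct (damped_fundamental rho2 d k al q r C S HC HS Hd Hk HW) as (S1 & S2 & W).
rewrite F1, F2.
exact (nonlinear_form_basis L rho2 d k P A _ _ HL Hr HA HP S1 S2 (fun t _ => W t)).
Qed.

Theorem mainTheorem1
  (L rho1 rho2 d k b : R) (chi : R -> R)
  (hL : 0 < L) (hrho1 : 0 < rho1) (hrho2 : 0 < rho2)
  (hd : 0 < d) (hk : 0 < k) (hb : 0 < b)
  (hchi : forall n s, ex_derive_n chi n s) (hchi0 : Derive chi 0 = b) :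
  (* (1) *)
  ((exists gamma, forall s, chi s = b * s + gamma) ->
     (forall X, linear_form L rho1 rho2 d k b X ->
        point_symmetry L rho1 rho2 d k chi X) /\
     (~ exceptional rho1 rho2 d k b ->
        forall X, point_symmetry L rho1 rho2 d k chi X ->
          linear_form L rho1 rho2 d k b X))
  /\
  (* (2) *)
  ((exists s, Derive_n chi 2 s <> 0) ->
     (forall X, point_symmetry L rho1 rho2 d k chi X <-> nonlinear_form L rho2 d k X)
     /\
     (d ^ 2 - 4 * k * rho2 = 0 ->
        is_basis L (point_symmetry L rho1 rho2 d k chi)
          [X1; X2; X3; X4; X5; X6 (2 * sqrt (rho2 / k));
           dpsi (fun t => exp (- sqrt (k / rho2) * t));
           dpsi (fun t => t * exp (- sqrt (k / rho2) * t))])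
     /\
     (forall lambda, 0 < lambda -> d ^ 2 - 4 * k * rho2 = lambda ^ 2 ->
        is_basis L (point_symmetry L rho1 rho2 d k chi)
          [X1; X2; X3; X4; X5; X6 (sqrt (lambda ^ 2 + 4 * k * rho2) / k);
           dpsi (fun t => exp (- (sqrt (lambda ^ 2 + 4 * k * rho2) / (2 * rho2)) * t)
                          * cosh (lambda * t / (2 * rho2)));
           dpsi (fun t => exp (- (sqrt (lambda ^ 2 + 4 * k * rho2) / (2 * rho2)) * t)
                          * sinh (lambda * t / (2 * rho2)))])
     /\
     (forall mu, 0 < mu -> d ^ 2 - 4 * k * rho2 = - mu ^ 2 ->
        is_basis L (point_symmetry L rho1 rho2 d k chi)
          [X1; X2; X3; X4; X5; X6 (sqrt (4 * k * rho2 - mu ^ 2) / k);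
           dpsi (fun t => exp (- (sqrt (4 * k * rho2 - mu ^ 2) / (2 * rho2)) * t)
                          * cos (mu * t / (2 * rho2)));
           dpsi (fun t => exp (- (sqrt (4 * k * rho2 - mu ^ 2) / (2 * rho2)) * t)
                          * sin (mu * t / (2 * rho2)))])).
Proof.
assert (hc : forall s, ex_derive (Derive chi) s) by (intros s; exact (hchi 2%nat s)).
split.
- intros [gamma Hgamma].
  assert (C1 : forall q, Derive chi q = b).
  { intros q; rewrite (Derive_ext chi _ q Hgamma).
    apply is_derive_unique; auto_derive; [trivial | ring]. }
  assert (C2 : forall q, Derive_n chi 2 q = 0).
  { intros q; change (Derive (Derive chi) q = 0).
    rewrite (Derive_ext _ _ q C1); apply Derive_const. }
  split.
  + intros X (c1 & c2 & c3 & f & g & Hf & Hg & Hfg & HX).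
    destruct (affine_admitted L rho1 rho2 d k chi c1 c2 c3 f g X hrho1 hrho2 hc Hf Hg HX)
      as [Hsm Hadm].
    split; [exact Hsm|]; apply Hadm.
    apply (solves_linear_inhomogeneity L rho1 rho2 d k b chi c3 f g C1 C2), Hfg.
  + intros Hexc X [Hsm Hadm].
    assert (Hraw := admitted_by_raw L rho1 rho2 d k chi X hc Hadm).
    assert (Hrig : rigid L X).
    { destruct (Req_dec (b * rho1) (k * rho2)) as [Heq|Hne].
      - apply (rigid_equal_speeds L rho1 rho2 d k b chi); trivial.
        intros H; apply Hexc; split; assumption.
      - apply (rigid_unequal_speeds L rho1 rho2 d k chi X 0); trivial.
        rewrite C1; lra. }
    destruct (rigid_affine L X hL Hsm Hrig) as (c1 & c2 & e & f & g & Hf & Hg & HX).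
    exists c1, c2, e, f, g; split; [exact Hf|]; split; [exact Hg|]; split; [|exact HX].
    apply (solves_linear_inhomogeneity L rho1 rho2 d k b chi e f g C1 C2).
    apply (affine_admitted L rho1 rho2 d k chi c1 c2 e f g X hrho1 hrho2 hc Hf Hg HX).
    exact Hadm.
- intros [s Hs].
  assert (HP : forall X, point_symmetry L rho1 rho2 d k chi X
                         <-> nonlinear_form L rho2 d k X).
  { intros X; split.
    - intros [Hsm Hadm].
      destruct (nonconstant_speed chi rho1 (k * rho2) s ltac:(lra) Hs) as [p0 Hp0].
      assert (Hrig := rigid_unequal_speeds L rho1 rho2 d k chi X p0 hrho1 hrho2 hk hd
        Hsm (admitted_by_raw L rho1 rho2 d k chi X hc Hadm) Hp0).
      destruct (rigid_affine L X hL Hsm Hrig) as (c1 & c2 & e & f & g & Hf & Hg & HX).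
      apply (nonlinear_affine_form L rho1 rho2 d k chi c1 c2 e f g s); trivial.
      apply (affine_admitted L rho1 rho2 d k chi c1 c2 e f g X hrho1 hrho2 hc Hf Hg HX).
      exact Hadm.
    - intros HX.
      destruct (nonlinear_form_affine L rho1 rho2 d k chi X hrho2 HX)
        as (c1 & c2 & f & g & Hf & Hg & HX' & HI).
      destruct (affine_admitted L rho1 rho2 d k chi c1 c2 0 f g X hrho1 hrho2 hc Hf Hg HX')
        as [Hsm Hadm].
      split; [exact Hsm | apply Hadm, HI]. }
  split; [exact HP|].
  assert (Hsq : forall z, z = d ^ 2 -> sqrt z = d)
    by (intros z ->; apply sqrt_pow2; lra).
  split; [|split].
  + intros Hdisc.
    assert (Pa := sqrt_pos (k / rho2)); assert (PA := sqrt_pos (rho2 / k)).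
    assert (Sa : sqrt (k / rho2) ^ 2 = k / rho2)
      by (apply pow2_sqrt, Rlt_le, Rdiv_lt_0_compat; assumption).
    assert (SA : sqrt (rho2 / k) ^ 2 = rho2 / k)
      by (apply pow2_sqrt, Rlt_le, Rdiv_lt_0_compat; assumption).
    apply (damped_basis L rho2 d k _ _ (sqrt (k / rho2)) 0 1 (fun _ => 1) (fun t => t));
      trivial.
    * apply nonneg_square_eq; [nra | lra |].
      transitivity (4 * k ^ 2 * sqrt (rho2 / k) ^ 2); [ring|].
      rewrite SA; transitivity (4 * k * rho2); [field; lra | lra].
    * intros t; auto_derive; [trivial | ring].
    * intros t; auto_derive; [trivial | ring].
    * apply nonneg_square_eq; [lra | nra |].
      transitivity (4 * k * rho2); [lra|].
      transitivity (4 * rho2 ^ 2 * sqrt (k / rho2) ^ 2); [rewrite Sa; field; lra | ring].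
    * rewrite Sa; field; lra.
    * intros t; lra.
    * intros t; ring.
    * intros t; ring.
  + intros lambda Hl Hdisc; rewrite (Hsq (lambda ^ 2 + 4 * k * rho2)) by lra.
    apply (damped_basis L rho2 d k _ _ (d / (2 * rho2))
      (lambda / (2 * rho2)) (lambda / (2 * rho2))
      (fun t => cosh (lambda * t / (2 * rho2))) (fun t => sinh (lambda * t / (2 * rho2))));
      trivial.
    * field; lra.
    * intros t; apply is_derive_scaled; [lra | apply derivable_pt_lim_cosh].
    * intros t; apply is_derive_scaled; [lra | apply derivable_pt_lim_sinh].
    * field; lra.
    * apply (Rmult_eq_reg_l (4 * rho2)); [|lra].
      transitivity (d ^ 2 - lambda ^ 2); [lra | field; lra].
    * intros t.
      replace (_ - _) with (lambda / (2 * rho2)).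
      { apply Rgt_not_eq, Rdiv_lt_0_compat; lra. }
      unfold cosh, sinh; rewrite exp_Ropp.
      assert (P := exp_pos (lambda * t / (2 * rho2))); field; lra.
  + intros mu Hm Hdisc; rewrite (Hsq (4 * k * rho2 - mu ^ 2)) by lra.
    apply (damped_basis L rho2 d k _ _ (d / (2 * rho2))
      (- (mu / (2 * rho2))) (mu / (2 * rho2))
      (fun t => cos (mu * t / (2 * rho2))) (fun t => sin (mu * t / (2 * rho2))));
      trivial.
    * field; lra.
    * intros t; rewrite Ropp_mult_distr_l_reverse, Ropp_mult_distr_r.
      apply (is_derive_scaled cos (fun y => - sin y)); [lra | apply derivable_pt_lim_cos].
    * intros t; apply is_derive_scaled; [lra | apply derivable_pt_lim_sin].
    * field; lra.
    * apply (Rmult_eq_reg_l (4 * rho2)); [|lra].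
      transitivity (d ^ 2 + mu ^ 2); [lra | field; lra].
    * intros t.
      replace (_ - _) with (mu / (2 * rho2)
        * (Rsqr (sin (mu * t / (2 * rho2))) + Rsqr (cos (mu * t / (2 * rho2)))))
        by (unfold Rsqr; ring).
      rewrite sin2_cos2, Rmult_1_r; apply Rgt_not_eq, Rdiv_lt_0_compat; lra.
Qed.
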